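(* Let $K\subseteq\mathbb{R}^2$ be a convex body, $\lambda\in[0,1]$, and let $x$ be the center of mass of $K$. Then \[ \mathrm{Area}\big((1-\lambda)(K-x)\vee\lambda(x-K)\big)\le \mathrm{Area}\big((1-\lambda)S\vee(-\lambda S)\big), \] where $S$ is a triangle with center of mass at the origin and $\mathrm{Area}(S)=\mathrm{Area}(K)$.
   Context: A convex body is a compact convex set with non-empty interior. For sets $A,B$, $A\vee B$ denotes the convex hull of $A\cup B$. *)

(* Defs.v *)
From HB Require Import structures.
From mathcomp Require Import all_boot all_order all_algebra.
From mathcomp Require Import all_classical all_reals all_analysis.
Set Implicit Arguments. Unset Strict Implicit. Unset Printing Implicit Defensive.
Import Order.TTheory GRing.Theory Num.Theory.
Import numFieldNormedType.Exports.
Local Open Scope classical_set_scope.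
Local Open Scope ring_scope.

Section Plane.
Variable R : realType.
Notation pt := (R * R)%type.

Definition Area (A : set pt) : \bar R :=
  ((@lebesgue_measure R) \x (@lebesgue_measure R))%E A.

Definition padd (p q : pt) : pt := (p.1 + q.1, p.2 + q.2).
Definition pscale (c : R) (p : pt) : pt := (c * p.1, c * p.2).

Definition convex_set2 (A : set pt) : Prop :=
  forall a b, A a -> A b -> forall t : R, 0 <= t -> t <= 1 ->
    A (padd (pscale (1 - t) a) (pscale t b)).

Definition conv_hull (A : set pt) : set pt :=
  \bigcap_(C in [set C | convex_set2 C /\ A `<=` C]) C.

Definition hull_join (A B : set pt) : set pt := conv_hull (A `|` B).

Definition convex_body (K : set pt) : Prop :=
  compact K /\ convex_set2 K /\ (interior K !=set0).

Definition scale_set (c : R) (A : set pt) : set pt := pscale c @` A.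
Definition translate (v : pt) (A : set pt) : set pt := padd v @` A.

Definition centroid (K : set pt) : pt :=
  let mu := ((@lebesgue_measure R) \x (@lebesgue_measure R))%E in
  (Rintegral mu K (fun p => p.1) / fine (Area K),
   Rintegral mu K (fun p => p.2) / fine (Area K)).

Definition triangle (S : set pt) : Prop :=
  exists a b c : pt,
    (b.1 - a.1) * (c.2 - a.2) - (b.2 - a.2) * (c.1 - a.1) != 0 /\
    S = conv_hull [set a; b; c].

End Plane.

(* Main.v *)
Require Import Defs.
From HB Require Import structures.
From mathcomp Require Import all_boot all_order all_algebra.
From mathcomp Require Import all_classical all_reals all_analysis.
From mathcomp Require Import measurable_realfun ring lra.
Import Order.TTheory GRing.Theory Num.Theory.
Import numFieldNormedType.Exports.
Local Open Scope classical_set_scope.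
Local Open Scope ring_scope.
Set Implicit Arguments. Unset Strict Implicit. Unset Printing Implicit Defensive.

(** Translate [K] so that its centroid is 0 and put [mu = 1 - lambda].
Seen from [p \in K], the centroid is an average of the points at 2/3 of the way
to the boundary, whence [- K / 2 \subset K].  So the hull is just [mu K] when
[lambda <= 1/3], and [- lambda K] when [lambda >= 2/3].

For [1/3 <= lambda <= 2/3] the hull has area at most [2 lambda mu |K|], because
[s |-> |conv (K \cup - s K)| / s] is convex and equals [2 |K|] at [s = 1/2] and
at [s = 2].  Concretely, a polygon inscribed in the hull is cut from 0 into
triangles whose vertices are of the form [mu p] or [- lambda p] with [p \in K].
Replacing these by [p] or [- p / 2], respectively by [- p / 2] or [p], gives two
families of non-overlapping triangles inside [K], and the area of each triangle
of the fan is at most a fixed combination, of total weight [2 lambda mu], of the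
areas of its two images.

When [S] is a triangle with centroid 0, [- S / 2 \subset S] forces the three
triangles cut from 0 to have equal areas, and the hull contains a hexagon of
area [2 lambda mu |S|]. *)

(** * Area under affine maps *)

(** Divide areas by [lambda * mu] and put [t = mu / lambda]. A fan triangle with two, one or no
    vertices from [mu K] then has area proportional to [t], [1] or [1 / t], and twice the areas of
    its two images in [K] are the values of this function at [t = 2] and [t = 1 / 2]. The weights
    are those that write [t] as a mean of [2] and [1 / 2]: they are non-negative exactly in the
    middle range, and one choice serves every triangle because the three functions are affine or
    convex in [t].

    The hull of a general [K] is no polygon, and a finite point set comes with no cyclic order.
    Hence the hull is approximated by a polygon on a finite net, whose enlargement by [1 + e]
    contains it, and the edges are recognised by signs of determinants alone. The bound on the
    polygon is exact; [e] tends to 0 only at the end. *)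

Lemma lebesgue_measure_affine (R : realType) (c d : R) (A : set R) : 0 < c ->
  measurable (A : set (measurableTypeR R)) ->
  (@lebesgue_measure R ((fun y => (c * y + d)%R) @^-1` A) =
   c^-1%:E * @lebesgue_measure R A)%E.
Proof.
move=> c0 mA.
have mf : measurable_fun [set: measurableTypeR R] ((fun y =>
    c * y + d) : measurableTypeR R -> measurableTypeR R).
  by apply: measurable_funD => //; apply: measurable_funM.
pose cc := NngNum (ltW c0).
pose pm : {measure set (measurableTypeR R) -> \bar R} :=
  measure_function_pushforward__canonical__measure_function_Measure (@lebesgue_measure R)
      mf.
(* The push-forward scaled by [c] gives every half-open interval its length, and this determines
   Lebesgue measure. *)
have E : (@lebesgue_measure R A = mscale cc pm A)%E.
  apply: lebesgue_measure_unique => //.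
  move=> _ [[a b]] _ <-.
  change (@lebesgue_measure R `]a, b] = c%:E * @lebesgue_measure R ((fun y : R =>
      (c * y + d)%R) @^-1` `]a, b]))%E.
  have -> : (fun y => c * y + d) @^-1` `]a, b] = `](a - d) / c, (b - d) / c]%classic.
    apply/seteqP; split => x /=; rewrite !in_itv /= ltr_pdivrMr// ler_pdivlMr// ltrBlDr
        lerBrDr mulrC //.
  rewrite !lebesgue_measure_itv /= !lte_fin ltr_pM2r ?invr_gt0// ltrD2r.
  case: ifPn => _; last by rewrite mule0.
  rewrite -EFinM -!EFinB; congr (_%:E); field; lra.
rewrite E; change (mscale cc pm A) with (c%:E * @lebesgue_measure R ((fun y : R =>
    (c * y + d)%R) @^-1` A))%E.
rewrite muleA -EFinM mulVf ?mul1e//; lra.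
Qed.

Lemma lebesgue_measure_affineN (R : realType) (c d : R) (A : set (measurableTypeR R)) : c
    != 0 ->
  measurable A ->
  (@lebesgue_measure R ((fun y => (c * y + d)%R) @^-1` A) = `|c|^-1%:E * @lebesgue_measure
      R A)%E.
Proof.
move=> c0 mA; case: (ltgtP c 0) => [cn|cp|ce].
- have -> : (fun y : R => c * y + d) @^-1` A = (-%R : R -> R) @^-1` ((fun y =>
    - c * y + d) @^-1` A).
    by apply/seteqP; split => y /=; rewrite mulrNN.
  rewrite [LHS](_ : _ = pushforward (@lebesgue_measure R) (-%R : _ ->
      measurableTypeR R) ((fun y : R => - c * y + d) @^-1` A))//.
  have mA' : measurable ((fun y : R => - c * y + d) @^-1` A : set (measurableTypeR R)).
    rewrite -[X in measurable X]setTI.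
    suff : measurable_fun [set: measurableTypeR R] ((fun y =>
        - c * y + d) : measurableTypeR R -> measurableTypeR R) by apply.
    by apply: measurable_funD => //; apply: measurable_funM.
  rewrite lebesgue_measureN// lebesgue_measure_affine// ?oppr_gt0//.
  by rewrite ltr0_norm.
- by rewrite lebesgue_measure_affine// gtr0_norm.
- by rewrite ce eqxx in c0.
Qed.

Section AffineArea.
Variable R : realType.
Notation lebesgue := (@lebesgue_measure R).
Notation plane := (measurableTypeR R * measurableTypeR R)%type.
Implicit Types (A : set plane).

(** [Area] is a bare set function; [area2] is the same product measure with its measure structure,
    so that general facts on measures and integrals apply. *)
Definition area2 : {measure set plane -> \bar R} := (lebesgue \x lebesgue)%E.

Lemma measurable_lin (a b c : R) :
  measurable_fun setT ((fun p => a * p.1 + b * p.2 + c) : plane -> measurableTypeR R).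
Proof.
by repeat apply: measurable_funD => //; apply: measurable_funM.
Qed.

(** The map sends each vertical line to itself, so the product measure can be computed slice by
    slice with the one-dimensional formula. *)
Lemma Area_vert (b c d : R) A : c != 0 -> measurable A ->
  (Area ((fun p => (p.1, c * p.2 + (b * p.1 + d))%R) @^-1` A) = `|c|^-1%:E * Area A)%E.
Proof.
move=> c0 mA; rewrite /Area /product_measure1.
rewrite -ge0_integralZl//=; last first.
  by apply: measurable_fun_xsection.
apply: eq_integral => x _ /=.
rewrite -(lebesgue_measure_affineN (b * x + d))//; last exact: measurable_xsection.
Qed.

(** The push-forward under the swap has the right values on rectangles, and these determine the
    product measure. *)
Lemma Area_swap A : measurable A -> Area ((fun p : R * R => (p.2, p.1)) @^-1` A) = Area A.
Proof.
move=> mA.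
have ms : measurable_fun [set: plane] ((fun p : plane => (p.2, p.1)) : plane -> plane).
  by apply: measurable_fun_pair.
pose m' : {measure set plane -> \bar R} :=
  measure_function_pushforward__canonical__measure_function_Measure area2 ms.
apply/esym; change (Area A = m' A).
apply: product_measure_unique => // B C mB mC.
change (area2 ((fun p : R * R => (p.2, p.1)) @^-1` (B `*` C)) = (lebesgue B * lebesgue
    C)%E).
have -> : (fun p : R * R => (p.2, p.1)) @^-1` (B `*` C) = C `*` B.
  by apply/seteqP; split => -[x y] /= [].
by rewrite muleC; exact: product_measure1E.
Qed.

Lemma Area_horiz (b c d : R) A : c != 0 -> measurable A ->
  (Area ((fun p => (c * p.1 + (b * p.2 + d), p.2)%R) @^-1` A) = `|c|^-1%:E * Area A)%E.
Proof.
move=> c0 mA.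
have ms : measurable_fun [set: plane] ((fun p : plane => (p.2, p.1)) : plane -> plane).
  by apply: measurable_fun_pair.
have mA' : measurable ((fun p : R * R => (p.2, p.1)) @^-1` A : set plane).
  by rewrite -[X in measurable X]setTI; exact: ms.
rewrite -(Area_swap mA) -(Area_vert b d c0 mA') -Area_swap //.
have mv : measurable_fun [set: plane] ((fun p =>
    (c * p.1 + (b * p.2 + d), p.2)) : plane -> plane).
  by apply: measurable_fun_pair => //; repeat apply: measurable_funD => //;
      apply: measurable_funM.
by rewrite -[X in measurable X]setTI; exact: mv.
Qed.

Lemma measurable_affine (a b e c d f : R) A : measurable A ->
  measurable ((fun p => (a * p.1 + b * p.2 + e, c * p.1 + d * p.2 + f)) @^-1` A : set
      plane).
Proof.
move=> mA; have mv : measurable_fun [set: plane]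
  ((fun p => (a * p.1 + b * p.2 + e, c * p.1 + d * p.2 + f)) : plane -> plane).
  by apply: measurable_fun_pair; exact: measurable_lin.
by rewrite -[X in measurable X]setTI; exact: mv.
Qed.

(** If [a != 0], the map is a horizontal one followed by a vertical one, with factors [a] and
    [(a * d - b * c) / a]. If [a = 0], then [b != 0], and exchanging the coordinates reduces to the
    first case. *)
Lemma Area_affine (a b e c d f : R) A : a * d - b * c != 0 -> measurable A ->
  (Area ((fun p => (a * p.1 + b * p.2 + e, c * p.1 + d * p.2 + f)%R) @^-1` A) =
   `|a * d - b * c|^-1%:E * Area A)%E.
Proof.
have main (a' b' c' d' : R) : a' != 0 -> a' * d' - b' * c' != 0 -> measurable A ->
  (Area ((fun p => (a' * p.1 + b' * p.2 + e, c' * p.1 + d' * p.2 + f)%R) @^-1` A) =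
   `|a' * d' - b' * c'|^-1%:E * Area A)%E.
  move=> a0 D0 mA.
  have k0 : (a' * d' - b' * c') / a' != 0 by rewrite mulf_neq0// invr_eq0.
  have -> : (fun p : R * R => (a' * p.1 + b' * p.2 + e, c' * p.1 + d' * p.2 + f)) @^-1` A =
     (fun p => (a' * p.1 + (b' * p.2 + e), p.2)) @^-1` ((fun p => (p.1,
        ((a' * d' - b' * c') / a') * p.2 + (c' / a' * p.1 + (f - c' * e / a')))) @^-1` A).
    apply/funext => -[x y]; rewrite /preimage /mkset /=.
    by congr (A (_, _)); field.
  rewrite Area_horiz// ?Area_vert// ?muleA -?EFinM.
    by rewrite normrM normfV; congr (_%:E * _)%E; field; rewrite !normr_eq0 a0 D0.
  have -> : (fun p : plane => (p.1,
        ((a' * d' - b' * c') / a') * p.2 + (c' / a' * p.1 + (f - c' * e / a')))) =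
       (fun p => (1 * p.1 + 0 * p.2 + 0, c' / a' * p.1 + ((a' * d' - b' * c') / a') * p.2
           + (f - c' * e / a'))).
    by apply/funext => -[x y] /=; congr (_, _); ring.
  exact: measurable_affine.
move=> D0 mA; have [a0|] := eqVneq a 0; last by move=> a0; exact: main.
rewrite -Area_swap; last exact: measurable_affine.
have b0 : b != 0 by apply: contraNneq D0 => ->; rewrite a0 !mul0r subr0.
have -> : `|a * d - b * c| = `|b * c - a * d| by rewrite distrC.
have D0' : b * c - a * d != 0 by rewrite -opprB oppr_eq0.
rewrite -(main b a d c b0 D0' mA).
congr (Area _); apply/funext => -[x y]; rewrite /preimage /mkset /=.
by congr (A (_, _)); ring.
Qed.

End AffineArea.

(** * Measurable sets of the plane, and triangles with a vertex at 0 *)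

Section PlaneSets.
Variable R : realType.
Notation lebesgue := (@lebesgue_measure R).
Notation plane := (measurableTypeR R * measurableTypeR R)%type.
Notation pt := (R * R)%type.

(** The boxes with rational corners inside [U] are countably many measurable rectangles, and they
    cover [U]. *)
Lemma open_measurable2 (U : set pt) : open U -> measurable (U : set plane).
Proof.
move=> oU.
pose box (q : rat * rat * (rat * rat)) : set plane :=
  `]ratr q.1.1, ratr q.1.2[%classic `*` `]ratr q.2.1, ratr q.2.2[%classic.
have -> : U = \bigcup_(q in [set q | box q `<=` U]) box q.
  apply/seteqP; split => [[x y] Uxy|p [q bU]]; last exact: bU.
  have : nbhs (x, y) U by rewrite nbhsE /=; exists U.
  move=> /nbhs_ballP[e /= e0 xeU].
  have [a ha] : exists a : rat, ratr a \in `]x - e, x[ by apply: rat_in_itvoo; lra.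
  have [b hb] : exists b : rat, ratr b \in `]x, x + e[ by apply: rat_in_itvoo; lra.
  have [c hc] : exists c : rat, ratr c \in `]y - e, y[ by apply: rat_in_itvoo; lra.
  have [d hd] : exists d : rat, ratr d \in `]y, y + e[ by apply: rat_in_itvoo; lra.
  rewrite !in_itv /= in ha hb hc hd.
  have bU : box ((a, b), (c, d)) `<=` U.
    move=> [u v] [/=]; rewrite !in_itv /= => hu hv; apply: xeU.
    by split; rewrite /= /ball /= ltr_norml; lra.
  by exists ((a, b), (c, d)) => //; split; rewrite /= in_itv /=; lra.
rewrite bigcup_mkcond; apply: countable_bigcupT_measurable => // q; case: ifPn => // _.
exact: measurableX.
Qed.

Lemma closed_measurable2 (U : set pt) : closed U -> measurable (U : set plane).
Proof. by move=> /closed_openC/open_measurable2/measurableC; rewrite setCK. Qed.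

Lemma compact_measurable2 (U : set pt) : compact U -> measurable (U : set plane).
Proof.
by move=> /compact_closed h; apply: closed_measurable2; apply: h; exact: norm_hausdorff.
Qed.

Lemma compact_bounded2 (U : set pt) : compact U ->
  exists2 M : R, 0 < M & forall p, U p -> `|p.1| <= M /\ `|p.2| <= M.
Proof.
move=> /compact_bounded[N [_ hN]].
have NN : N < `|N| + 1 by rewrite ltr_pwDr// ler_norm.
exists (`|N| + 1) => [|p /(hN _ NN)]; first by rewrite ltr_wpDl.
by rewrite /= prod_normE ge_max => /andP[-> ->].
Qed.

Lemma compact_Area_lty (U : set pt) : compact U -> (Area U < +oo)%E.
Proof.
move=> cU; have [M M0 hM] := compact_bounded2 cU.
pose I := `[-M, M]%classic : set (measurableTypeR R).
have mI0 : measurable I by exact: measurable_itv.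
have mI : measurable (I `*` I : set plane) by exact: measurableX.
apply: (@le_lt_trans _ _ (@area2 R (I `*` I))).
  apply: (@le_measure _ _ _ (@area2 R)); rewrite ?inE//; first exact: compact_measurable2.
  by move=> p /hM[]; rewrite !ler_norml => h1 h2; split; rewrite /I /= in_itv.
have -> : (@area2 R (I `*` I) = lebesgue I * lebesgue I)%E by exact: product_measure1E.
by rewrite /I !lebesgue_measure_itv /= lte_fin; case: ifP => _;
    rewrite -?EFinB -?EFinM ?mule0 ?ltry.
Qed.

Lemma scale_preimage (c : R) (A : set plane) : c != 0 ->
  scale_set c A =
  (fun p : pt => (c^-1 * p.1 + 0 * p.2 + 0, 0 * p.1 + c^-1 * p.2 + 0)) @^-1` A.
Proof.
move=> c0; apply/seteqP; split => [_ [[x y] Axy <-]|[x y]] /=.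
  by rewrite !mul0r !addr0 add0r !mulrA mulVf// !mul1r.
rewrite !mul0r !addr0 add0r => Axy; exists (c^-1 * x, c^-1 * y) => //=.
by rewrite /pscale /= !mulrA divff// !mul1r.
Qed.

Lemma Area_scale (c : R) (A : set plane) : c != 0 -> measurable A ->
  Area (scale_set c A) = ((c ^+ 2)%:E * Area A)%E.
Proof.
move=> c0 mA; rewrite scale_preimage//.
have i0 : c^-1 != 0 by rewrite invr_eq0.
rewrite Area_affine//; last by rewrite mul0r subr0 mulf_neq0.
rewrite mul0r subr0 normrM; congr (_ %:E * _)%E.
by rewrite -normrM -expr2 normrX real_normK ?num_real// exprVn invrK.
Qed.

Lemma measurable_scale (c : R) (A : set plane) : c != 0 -> measurable A ->
  measurable (scale_set c A : set plane).
Proof. by move=> c0 mA; rewrite scale_preimage//; exact: measurable_affine. Qed.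

Lemma translate_preimage (v : pt) (A : set plane) :
  translate v A = (fun p : pt => (1 * p.1 + 0 * p.2 + - v.1, 0 * p.1 + 1 * p.2 + - v.2))
      @^-1` A.
Proof.
case: v => v w; apply/seteqP; split => [_ [[x y] Axy <-]|[x y]] /=.
  by rewrite !mul0r !mul1r add0r addr0 ![_ + x]addrC ![_ + y]addrC !addrK.
rewrite !mul0r !mul1r add0r addr0 => Axy; exists (x - v, y - w) => //=.
by rewrite /padd /= !subrKC.
Qed.

Lemma Area_translate (v : pt) (A : set plane) : measurable A ->
  Area (translate v A) = Area A.
Proof.
move=> mA; rewrite translate_preimage Area_affine// !mulr0 mulr1 subr0 ?oner_eq0//.
by rewrite normr1 invr1 mul1e.
Qed.

Definition det (p q : pt) : R := p.1 * q.2 - p.2 * q.1.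

Lemma measurable_line (x : pt) : measurable ([set z | det x z = 0] : set plane).
Proof.
rewrite -[X in measurable X]setTI.
have -> : [set z | det x z = 0] = (fun p : plane =>
    - x.2 * p.1 + x.1 * p.2 + 0) @^-1` [set 0].
  by apply/seteqP; split => p /=; rewrite /det => e; lra.
exact: (measurable_lin (- x.2) x.1 0).
Qed.

Lemma Area_line (x : pt) : x != (0, 0) -> Area [set z | det x z = 0] = 0%E.
Proof.
case: x => a b; rewrite xpair_eqE negb_and => ab0.
(* A similarity of determinant [a ^+ 2 + b ^+ 2], whose second coordinate is [det (a, b)], carries
   the line to the horizontal axis, of measure [+oo * 0 = 0]. *)
have -> : [set z | det (a, b) z = 0] = (fun p : pt =>
    (a * p.1 + b * p.2 + 0, - b * p.1 + a * p.2 + 0)) @^-1` ([set: R] `*` [set 0]).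
  apply/seteqP; split => p /=; rewrite /det /= => e; last by case: e => _ e; lra.
  by split => //; lra.
rewrite Area_affine.
- have -> : (Area ([set: R] `*` [set 0%R]) = lebesgue [set: R] * lebesgue [set 0%R])%E by
    exact: product_measure1E.
  by rewrite lebesgue_measure_set1 !mule0.
- have : 0 < a ^+ 2 + b ^+ 2.
    case/orP: ab0 => h; first by rewrite ltr_pwDl ?sqr_ge0// lt0r sqr_ge0 sqrf_eq0 h.
    by rewrite ltr_wpDl ?sqr_ge0// lt0r sqr_ge0 sqrf_eq0 h.
  by move=> h; rewrite gt_eqF//; nra.
- exact: measurableX.
Qed.

(* Half-open, so that no null sets have to be removed: the triangles over disjoint
open cones are disjoint and the area is still exactly proportional to [det]. *)
Definition tri (x y : pt) : set pt :=
  [set z | [/\ 0 < det z y, 0 < det x z & det z y + det x z <= det x y]].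

Lemma measurable_tri x y : measurable (tri x y : set plane).
Proof.
have -> : tri x y =
   ((fun p : plane => y.2 * p.1 + - y.1 * p.2 + 0) @^-1` `]0, +oo[) `&`
   ((fun p : plane => - x.2 * p.1 + x.1 * p.2 + 0) @^-1` `]0, +oo[) `&`
   ((fun p : plane => (y.2 - x.2) * p.1 + (x.1 - y.1) * p.2 + 0) @^-1` `]-oo, det x y]).
  apply/seteqP; split => p; rewrite /tri /mkset /= !in_itv /= /det !andbT.
    by case=> h1 h2 h3; repeat split; lra.
  by case=> -[] h1 h2 h3; repeat split; lra.
have M a b c B : measurable (B : set (measurableTypeR R)) -> measurable ((fun p : plane =>
    a * p.1 + b * p.2 + c) @^-1` B).
  by move=> mB; rewrite -[X in measurable X]setTI; exact: measurable_lin.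
by apply: measurableI; first apply: measurableI; apply: M.
Qed.

(** Its value 1/2 is never computed: it is the unit in which upper and lower bounds are both
    expressed. *)
Definition simplex_area : \bar R := Area (tri (1, 0) (0, 1)).

(** The coordinates of [p] in the basis [x], [y] are [det p y / det x y] and [det x p / det x y];
    the coordinate map has determinant [1 / det x y]. *)
Lemma Area_tri x y : 0 < det x y -> Area (tri x y) = ((det x y)%:E * simplex_area)%E.
Proof.
move=> D0; have D0' : det x y != 0 by lra.
have -> : tri x y = (fun p : pt => (y.2 / det x y * p.1 + - y.1 / det x y * p.2 + 0,
     - x.2 / det x y * p.1 + x.1 / det x y * p.2 + 0)) @^-1` (tri (1, 0) (0, 1)).
  apply/seteqP; split => p.
    move=> [h1 h2 h3]; split.
    - rewrite [X in 0 < X](_ : _ = det p y / det x y); first by rewrite divr_gt0.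
      by rewrite /det /=; field.
    - rewrite [X in 0 < X](_ : _ = det x p / det x y); first by rewrite divr_gt0.
      by rewrite /det /=; field.
    - rewrite [X in _ <= X](_ : _ = 1); last by rewrite /det /=; ring.
      rewrite [X in X <= _](_ : _ = (det p y + det x p) / det x y);
          first by rewrite ler_pdivrMr// mul1r.
      by rewrite /det /=; field.
  case; rewrite [X in 0 < X -> _](_ : _ = det p y / det x y); last by rewrite /det /=;
      field.
  rewrite pmulr_lgt0 ?invr_gt0// => h1.
  rewrite [X in 0 < X -> _](_ : _ = det x p / det x y); last by rewrite /det /=; field.
  rewrite pmulr_lgt0 ?invr_gt0// => h2.
  rewrite [X in _ <= X -> _](_ : _ = 1); last by rewrite /det /=; ring.
  rewrite [X in X <= _ -> _](_ : _ = (det p y + det x p) / det x y);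
      last by rewrite /det /=; field.
  by rewrite ler_pdivrMr// mul1r => h3.
rewrite Area_affine//; last exact: measurable_tri.
  congr (_%:E * _)%E.
  rewrite [X in `|X|](_ : _ = (det x y)^-1); first by rewrite normfV invrK gtr0_norm.
  by rewrite /det; field.
rewrite [X in X != 0](_ : _ = (det x y)^-1); first by rewrite invr_eq0.
by rewrite /det; field.
Qed.
End PlaneSets.

(** * Fan triangulation of a finite point set *)

Section Fan.
Variables (R : realType) (I : finType) (x : I -> R * R).

Lemma det_antisym (p q : R * R) : det p q = - det q p.
Proof. by rewrite /det; ring. Qed.

Lemma det_plucker (a b c d : R * R) :
  det a b * det c d = det c b * det a d - det a c * det d b.
Proof. by rewrite /det; ring. Qed.

(* [(x i, x j)] is an edge, counterclockwise, of the convex hull of the points: all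
points lie on the left of the line through them (where 0 lies too).  The second
clause excludes points in the relative interior of the edge; without it, edges on
a common line could overlap. *)
Definition edge (i j : I) : bool :=
  (0 < det (x i) (x j)) &&
  [forall k, (det (x k) (x j) + det (x i) (x k) <= det (x i) (x j)) &&
     ((0 < det (x k) (x j)) ==> (0 < det (x i) (x k)) ==>
       (det (x k) (x j) + det (x i) (x k) < det (x i) (x j)))].

Lemma edgeP i j : edge i j -> 0 < det (x i) (x j) /\
  forall k, det (x k) (x j) + det (x i) (x k) <= det (x i) (x j) /\
     (0 < det (x k) (x j) -> 0 < det (x i) (x k) ->
       det (x k) (x j) + det (x i) (x k) < det (x i) (x j)).
Proof.
move=> /andP[D0 /forallP h]; split=> // k; have /andP[h1 h2] := h k; split=> // a b.
by move: h2; rewrite a b.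
Qed.

(** For [0 < det p q] this is the open cone spanned by [p] and [q], because
    [det p q * z = det z q * p + det p z * q]. *)
Definition in_cone (p q z : R * R) := 0 < det z q /\ 0 < det p z.

(** Each edge line leaves all the points on the side of 0, so along the ray of [z] neither line is
    met before the other. Both are met at the same place, which forces the four endpoints onto one
    line, where the strict clause of [edge] rules out a partial overlap. *)
Lemma edge_disjoint i j k l z : injective x -> edge i j -> edge k l ->
  in_cone (x i) (x j) z -> in_cone (x k) (x l) z -> (i, j) = (k, l).
Proof.
move=> xinj /edgeP[D0 hD] /edgeP[E0 hE] [a0 b0] [c0 d0].
set D := det (x i) (x j) in D0 hD.
set E := det (x k) (x l) in E0 hE.
set a := det z (x j) in a0; set b := det (x i) z in b0.
set c := det z (x l) in c0; set d := det (x k) z in d0.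
have [hp _] := hD k; have [hq _] := hD l.
have [hp' _] := hE i; have [hq' _] := hE j.
(* Up to the factor [D * E], the left side is the difference of the levels [(c + d) / E] and
   [(a + b) / D] of [z] with respect to the two lines. By [e1] and [e2] it has both signs, so every
   summand vanishes. *)
have e1 : D * (c + d) - E * (a + b) =
     (D - (det (x k) (x j) + det (x i) (x k))) * c +
     (D - (det (x l) (x j) + det (x i) (x l))) * d.
  by rewrite /D /E /a /b /c /d /det; ring.
have e2 : E * (a + b) - D * (c + d) =
     (E - (det (x i) (x l) + det (x k) (x i))) * a +
     (E - (det (x j) (x l) + det (x k) (x j))) * b.
  by rewrite /D /E /a /b /c /d /det; ring.
have n1 : 0 <= (D - (det (x k) (x j) + det (x i) (x k))) * c by rewrite mulr_ge0//; lra.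
have n2 : 0 <= (D - (det (x l) (x j) + det (x i) (x l))) * d by rewrite mulr_ge0//; lra.
have n3 : 0 <= (E - (det (x i) (x l) + det (x k) (x i))) * a by rewrite mulr_ge0//; lra.
have n4 : 0 <= (E - (det (x j) (x l) + det (x k) (x j))) * b by rewrite mulr_ge0//; lra.
have z1 : (D - (det (x k) (x j) + det (x i) (x k))) * c == 0 by lra.
have z2 : (D - (det (x l) (x j) + det (x i) (x l))) * d == 0 by lra.
have {z1} : D - (det (x k) (x j) + det (x i) (x k)) = 0.
  by apply/eqP; move: z1; rewrite mulf_eq0 (gt_eqF c0) orbF.
have {z2} : D - (det (x l) (x j) + det (x i) (x l)) = 0.
  by apply/eqP; move: z2; rewrite mulf_eq0 (gt_eqF d0) orbF.
move=> s2 s1.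
have [_ t1] := hD k; have [_ t2] := hD l.
have [_ t3] := hE i; have [_ t4] := hE j.
have ED : E = det (x i) (x l) - det (x i) (x k).
  apply: (@mulfI _ D); first by rewrite gt_eqF.
  have : D * E = det (x k) (x j) * det (x i) (x l) - det (x i) (x k) * det (x l) (x j).
    by rewrite /D /E det_plucker.
  have -> : det (x k) (x j) = D - det (x i) (x k) by lra.
  have -> : det (x l) (x j) = D - det (x i) (x l) by lra.
  by move=> ->; ring.
have f1 : D * c = a * det (x i) (x l) - b * det (x l) (x j).
  by rewrite /D /c /a /b /det; ring.
have f2 : D * d = - a * det (x i) (x k) + b * det (x k) (x j).
  by rewrite /D /d /a /b /det; ring.
have Dc : 0 < D * c by rewrite mulr_gt0.
have Dd : 0 < D * d by rewrite mulr_gt0.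
rewrite (det_antisym (x k) (x i)) in t3.
rewrite (det_antisym (x j) (x l)) in t4.
move: t1 t2 t3 t4 s1 s2 ED f1 f2.
set p := det (x k) (x j); set q := det (x i) (x k).
set r := det (x l) (x j); set s := det (x i) (x l).
move=> t1 t2 t3 t4 s1 s2 ED f1 f2.
clear e1 e2 n1 n2 n3 n4 hp hq hp' hq' hD hE.
(* Here [D * x k = p * x i + q * x j] and [D * x l = r * x i + s * x j], with [p + q = r + s = D].
   If [q > 0], then [x k] is strictly between [x i] and [x j], against [t1], or it is at or beyond
   [x j], against [0 < d]. Below, [q < 0] or [r < 0] would put [x i] or [x j] strictly inside the
   other edge. *)
have q0 : q <= 0.
  rewrite leNgt; apply/negP => q0; have [p0|p0] := ltP 0 p; first by have := t1 p0 q0; lra.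
  have : 0 < a * q by rewrite mulr_gt0.
  have : 0 <= b * - p by rewrite mulr_ge0//; lra.
  lra.
have r0 : r <= 0.
  rewrite leNgt; apply/negP => r0; have [w0|w0] := ltP 0 s; first by have := t2 r0 w0; lra.
  have : 0 < b * r by rewrite mulr_gt0.
  have : 0 <= a * - s by rewrite mulr_ge0//; lra.
  lra.
have {}q0 : q = 0.
  apply/eqP; rewrite eq_le q0 /= leNgt; apply/negP => qn.
  have s0 : 0 < s by lra.
  by have := t3 s0; rewrite oppr_gt0 => /(_ qn); lra.
have {}r0 : r = 0.
  apply/eqP; rewrite eq_le r0 /= leNgt; apply/negP => rn.
  have p0 : 0 < p by lra.
  by have := t4 _ p0; rewrite oppr_gt0 => /(_ rn); lra.
have ki : x k = x i.
  have e3 : D * (x k).1 = p * (x i).1 + q * (x j).1 by rewrite /D /p /q /det; ring.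
  have e4 : D * (x k).2 = p * (x i).2 + q * (x j).2 by rewrite /D /p /q /det; ring.
  have pD : p = D by lra.
  rewrite q0 pD !mul0r !addr0 in e3 e4.
  rewrite [x k]surjective_pairing [x i]surjective_pairing.
  by congr (_, _); apply: (@mulfI _ D) => //; rewrite gt_eqF.
have lj : x l = x j.
  have e3 : D * (x l).1 = r * (x i).1 + s * (x j).1 by rewrite /D /r /s /det; ring.
  have e4 : D * (x l).2 = r * (x i).2 + s * (x j).2 by rewrite /D /r /s /det; ring.
  have pD : s = D by lra.
  rewrite r0 pD !mul0r !add0r in e3 e4.
  rewrite [x l]surjective_pairing [x j]surjective_pairing.
  by congr (_, _); apply: (@mulfI _ D) => //; rewrite gt_eqF.
by rewrite (xinj _ _ ki) (xinj _ _ lj).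
Qed.

(* Among the pairs whose cone contains [z], take one whose line meets the ray of [z]
farthest from 0 and, among these, one with the least determinant: any point
violating the edge condition would give a better pair. *)
Lemma edge_cover z : (forall k, det (x k) z != 0) ->
  (exists i j, 0 < det (x i) (x j) /\ in_cone (x i) (x j) z) ->
  exists i j, edge i j /\ in_cone (x i) (x j) z.
Proof.
move=> gen [i0 [j0 [D00 [a00 b00]]]].
pose P (ij : I * I) := [&& 0 < det (x ij.1) (x ij.2), 0 < det z (x ij.2) & 0 < det (x
    ij.1) z].
(* The ray of [z] meets the line of the pair at [z / F], so the farthest line has the least [F]. *)
pose F (ij : I * I) := (det z (x ij.2) + det (x ij.1) z) / det (x ij.1) (x ij.2).
have P0 : P (i0, j0) by rewrite /P D00 a00 b00.
case: (@arg_minP _ _ _ (i0, j0) P F P0) => ij1 P1 min1.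
pose Q ij := P ij && (F ij == F ij1).
have Q1 : Q ij1 by rewrite /Q P1 eqxx.
case: (@arg_minP _ _ _ ij1 Q (fun ij => det (x ij.1) (x ij.2)) Q1) =>
    -[i j] /andP[PP /eqP Fij] min2.
have {}min1 kl : P kl -> F (i, j) <= F kl by rewrite Fij; exact: min1.
have {}min2 kl : P kl -> F kl = F (i, j) -> det (x i) (x j) <= det (x kl.1) (x kl.2).
  by move=> Pk Fk; apply: min2; rewrite /Q Pk Fk Fij eqxx.
move: PP; rewrite /P /= => /and3P[D0 a0 b0].
exists i, j; split => //; rewrite /edge D0 /=; apply/forallP => k.
set D := det (x i) (x j) in D0 *.
set a := det z (x j) in a0; set b := det (x i) z in b0.
set al := det (x k) (x j); set be := det (x i) (x k).
have Dc : D * det (x k) z = al * b - be * a by rewrite /D det_plucker.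
suff : D <= al + be -> al + be = D /\ (0 < al -> 0 < be -> False).
  move=> h; have [hh|hh] := leP D (al + be); last by rewrite ltW //= !implybT.
  by have [-> h2] := h hh; rewrite lexx /=; apply/implyP => al0; apply/implyP => be0;
      exfalso; exact: h2.
move=> hD.
(* The side of [z] on which [x k] lies decides which endpoint it replaces if the new cone is still
   to contain [z]. *)
have [c0|c0] : 0 < det (x k) z \/ det (x k) z < 0.
  by have := gen k; rewrite neq_lt => /orP[]; [right|left].
- have Dc0 : 0 < al * b - be * a by rewrite -Dc mulr_gt0.
  have al0 : 0 < al.
    rewrite ltNge; apply/negP => al0.
    have : 0 <= - al * b by rewrite mulr_ge0; lra.
    have : 0 <= be * a by rewrite mulr_ge0; lra.
    lra.
  have Pkj : P (k, j) by rewrite /P /= al0 a0 c0.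
  have FE : F (k, j) - F (i, j) = (a / (al * D)) * (D - (al + be)).
    rewrite /F /= -/a -/b -/al -/D.
    have -> : det (x k) z = (al * b - be * a) / D by rewrite -Dc mulrC mulKf // gt_eqF.
    by field; rewrite !gt_eqF.
  have pos : 0 < a / (al * D) by rewrite divr_gt0 ?mulr_gt0.
  have := min1 _ Pkj; rewrite -subr_ge0 FE pmulr_rge0// => h.
  have sD : al + be = D by lra.
  split=> // _ be0.
  have := min2 _ Pkj; rewrite /= -/al -/D => /(_ _)/wrap[].
    by apply/eqP; rewrite -subr_eq0 FE sD subrr mulr0.
  lra.
- have Dc0 : al * b - be * a < 0 by rewrite -Dc pmulr_rlt0 //.
  have be0 : 0 < be.
    rewrite ltNge; apply/negP => be0.
    have : 0 <= al * b by rewrite mulr_ge0; lra.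
    have : 0 <= - be * a by rewrite mulr_ge0; lra.
    lra.
  have zk : det z (x k) = - det (x k) z by rewrite det_antisym.
  have Pik : P (i, k) by rewrite /P /= be0 b0 zk oppr_gt0 c0.
  have FE : F (i, k) - F (i, j) = (b / (be * D)) * (D - (al + be)).
    rewrite /F /= -/a -/b -/be -/D zk.
    have -> : det (x k) z = (al * b - be * a) / D by rewrite -Dc mulrC mulKf // gt_eqF.
    by field; rewrite !gt_eqF.
  have pos : 0 < b / (be * D) by rewrite divr_gt0 ?mulr_gt0.
  have := min1 _ Pik; rewrite -subr_ge0 FE pmulr_rge0// => h.
  have sD : al + be = D by lra.
  split=> // al0 _.
  have := min2 _ Pik; rewrite /= -/be -/D => /(_ _)/wrap[].
    by apply/eqP; rewrite -subr_eq0 FE sD subrr mulr0.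
  lra.
Qed.
End Fan.

(** * Area of a fan *)

Section MeasureSums.
Variables (d : measure_display) (T : measurableType d) (R : realType).
Variables (mu : {measure set T -> \bar R}) (I : choiceType).
Local Open Scope ereal_scope.

Lemma le_measure_bigsetU (s : seq I) (P : pred I) (F : I -> set T) :
  (forall i, measurable (F i)) ->
  mu (\big[setU/set0]_(i <- s | P i) F i) <= \sum_(i <- s | P i) mu (F i).
Proof.
move=> mF; elim: s => [|a s IH]; first by rewrite !big_nil measure0.
rewrite !big_cons; case: ifP => // _.
apply: le_trans (leeD2l _ IH); apply: measureU2 => //.
by apply: bigsetU_measurable.
Qed.

Lemma sum_measure_disjoint (s : seq I) (P : pred I) (F : I -> set T) : uniq s ->
  (forall i, measurable (F i)) ->
  (forall i j z, P i -> P j -> F i z -> F j z -> i = j) ->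
  \sum_(i <- s | P i) mu (F i) = mu (\big[setU/set0]_(i <- s | P i) F i).
Proof.
move=> us mF dF; elim: s us => [|a s IH] /=; first by rewrite !big_nil measure0.
move=> /andP[as_ us]; rewrite !big_cons; case: ifP => Pa; last exact: IH.
rewrite IH// measureU//; first by apply: bigsetU_measurable.
rewrite -bigcup_seq_cond; apply/seteqP; split => // z [Faz [i /= /andP[si Pi] Fiz]].
by move: as_; rewrite (dF _ _ _ Pa Pi Faz Fiz) si.
Qed.

End MeasureSums.

Section FanArea.
Variables (R : realType) (I : finType) (x : I -> R * R).
Notation plane := (measurableTypeR R * measurableTypeR R)%type.
Notation area2 := (@area2 R).

Lemma simplex_area_ge0 : (0 <= simplex_area R)%E.
Proof. exact: (measure_ge0 area2). Qed.

Lemma Area_le (A B : set plane) : measurable A -> measurable B -> A `<=` B ->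
    (Area A <= Area B)%E.
Proof. by move=> mA mB AB; apply: (@le_measure _ _ _ area2); rewrite ?inE. Qed.

Lemma pairP (p q : R * R) : p.1 = q.1 -> p.2 = q.2 -> p = q.
Proof. by case: p q => [a b] [c d] /= -> ->. Qed.

Lemma tri_subset (L : set (R * R)) u v : convex_set2 L -> L (0, 0) -> L u -> L v ->
  tri u v `<=` L.
Proof.
move=> cL L0 Lu Lv z [a0 b0 ab].
set D := det u v in ab; set a := det z v in a0 ab; set b := det u z in b0 ab.
have D0 : 0 < D by lra.
have ab0 : 0 < a + b by lra.
(* Since [D * z = a * u + b * v], the ray of [z] meets the segment from [u] to [v]; that point is
   then shrunk towards 0 by [(a + b) / D <= 1]. *)
have Lw := cL u v Lu Lv (b / (a + b)).
have {Lw} : L ((a * u.1 + b * v.1) / (a + b), (a * u.2 + b * v.2) / (a + b)).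
  have h1 : 0 <= b / (a + b) by rewrite divr_ge0//; lra.
  have h2 : b / (a + b) <= 1 by rewrite ler_pdivrMr//; lra.
  have := Lw h1 h2; congr L; apply: pairP => /=; field; lra.
move=> Lw; have := cL _ _ L0 Lw ((a + b) / D).
have h1 : 0 <= (a + b) / D by rewrite divr_ge0//; lra.
have h2 : (a + b) / D <= 1 by rewrite ler_pdivrMr//; lra.
move=> /(_ h1 h2); congr L; apply: pairP => /=.
  transitivity ((a * u.1 + b * v.1) / D); first by field; rewrite !gt_eqF.
  have -> : a * u.1 + b * v.1 = z.1 * D by rewrite /a /b /D /det; ring.
  by rewrite mulfK// gt_eqF.
transitivity ((a * u.2 + b * v.2) / D); first by field; rewrite !gt_eqF.
have -> : a * u.2 + b * v.2 = z.2 * D by rewrite /a /b /D /det; ring.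
by rewrite mulfK// gt_eqF.
Qed.

Lemma sum_tri_le (L : set plane) (P : pred (I * I)) (u : I -> R * R) :
  measurable L -> convex_set2 L -> L (0, 0) -> (forall i, L (u i)) ->
  (forall e, P e -> 0 < det (u e.1) (u e.2)) ->
  (forall e f z, P e -> P f -> in_cone (u e.1) (u e.2) z -> in_cone (u f.1) (u f.2) z ->
      e = f) ->
  (\sum_(e | P e) (det (u e.1) (u e.2))%:E * simplex_area R <= Area L)%E.
Proof.
move=> mL cL L0 Lu Pd Pdisj.
under eq_bigr => e Pe do rewrite -Area_tri ?Pd//.
rewrite (@sum_measure_disjoint _ _ _ area2 _ (index_enum _) P (fun e =>
    tri (u e.1) (u e.2))).
- apply: Area_le => //; first by apply: bigsetU_measurable => e _; exact: measurable_tri.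
  rewrite -bigcup_seq_cond; apply: bigcup_sub => e _; exact: tri_subset.
- exact: index_enum_uniq.
- by move=> e; exact: measurable_tri.
- by move=> e f z Pe Pf [a1 b1 _] [a2 b2 _]; apply: (Pdisj _ _ z).
Qed.

(* The scalings by [s > 0] and by [t < 0] both move the fan into [L] without creating
overlaps, and multiply the area of the triangle [(i, j)] by [s i * s j] and
[t i * t j]. *)
Lemma fan_bound (s t : I -> R) (A B : R) (L : set plane) :
  injective x -> measurable L -> convex_set2 L -> L (0, 0) ->
  (forall i, 0 < s i /\ L (pscale (s i) (x i))) ->
  (forall i, t i < 0 /\ L (pscale (t i) (x i))) ->
  0 <= A -> 0 <= B -> (forall i j, 1 <= A * (s i * s j) + B * (t i * t j)) ->
  (\sum_(e | edge x e.1 e.2) (det (x e.1) (x e.2))%:E * simplex_area R <= (A + B)%:E *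
      Area L)%E.
Proof.
move=> xinj mL cL L0 hs ht A0 B0 hAB.
have detZ (a b : R) p q : det (pscale a p) (pscale b q) = a * b * det p q.
  by rewrite /det /=; ring.
have Ss : (\sum_(e | edge x e.1 e.2) (det (pscale (s e.1) (x e.1)) (pscale (s e.2) (x
    e.2)))%:E * simplex_area R <= Area L)%E.
  apply: (@sum_tri_le L (fun e => edge x e.1 e.2) (fun i => pscale (s i) (x i))) => //.
  - by move=> i; case: (hs i).
  - move=> e /edgeP[D0 _]; rewrite detZ; case: (hs e.1) => s1 _; case: (hs e.2) => s2 _.
    by rewrite !mulr_gt0.
  - move=> [e1 e2] [f1 f2] z /= Ee Ef [p1 p2] [q1 q2];
      apply: (@edge_disjoint _ _ x e1 e2 f1 f2 z) => //.
      split.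
        have : 0 < s e2 * det z (x e2) by move: p1; rewrite /det /=; lra.
        by rewrite pmulr_rgt0//; case: (hs e2).
      have : 0 < s e1 * det (x e1) z by move: p2; rewrite /det /=; lra.
      by rewrite pmulr_rgt0//; case: (hs e1).
    split.
      have : 0 < s f2 * det z (x f2) by move: q1; rewrite /det /=; lra.
      by rewrite pmulr_rgt0//; case: (hs f2).
    have : 0 < s f1 * det (x f1) z by move: q2; rewrite /det /=; lra.
    by rewrite pmulr_rgt0//; case: (hs f1).
have St : (\sum_(e | edge x e.1 e.2) (det (pscale (t e.1) (x e.1)) (pscale (t e.2) (x
    e.2)))%:E * simplex_area R <= Area L)%E.
  apply: (@sum_tri_le L (fun e => edge x e.1 e.2) (fun i => pscale (t i) (x i))) => //.
  - by move=> i; case: (ht i).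
  - move=> e /edgeP[D0 _]; rewrite detZ; case: (ht e.1) => s1 _; case: (ht e.2) => s2 _.
    by rewrite mulr_gt0// nmulr_rgt0.
  - move=> [e1 e2] [f1 f2] z /= Ee Ef [p1 p2] [q1 q2].
    (* Negative factors send the cone of an edge to the opposite cone, so disjointness is tested at
       [- z]. *)
    apply: (@edge_disjoint _ _ x e1 e2 f1 f2 (- z.1, - z.2)) => //.
      split.
        have : 0 < - t e2 * det (- z.1, - z.2) (x e2) by move: p1; rewrite /det /=; lra.
        by rewrite pmulr_rgt0// oppr_gt0; case: (ht e2).
      have : 0 < - t e1 * det (x e1) (- z.1, - z.2) by move: p2; rewrite /det /=; lra.
      by rewrite pmulr_rgt0// oppr_gt0; case: (ht e1).
    split.
      have : 0 < - t f2 * det (- z.1, - z.2) (x f2) by move: q1; rewrite /det /=; lra.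
      by rewrite pmulr_rgt0// oppr_gt0; case: (ht f2).
    have : 0 < - t f1 * det (x f1) (- z.1, - z.2) by move: q2; rewrite /det /=; lra.
    by rewrite pmulr_rgt0// oppr_gt0; case: (ht f1).
rewrite EFinD ge0_muleDl ?lee_fin//.
have A0' : (0 <= A%:E)%E by rewrite lee_fin.
have B0' : (0 <= B%:E)%E by rewrite lee_fin.
apply: le_trans (leeD (lee_wpmul2l A0' Ss) (lee_wpmul2l B0' St)).
have pd e : edge x e.1 e.2 -> (0 < det (x e.1) (x e.2)) by move=> /edgeP[].
have ps e : 0 < s e by case: (hs e).
have pt e : t e < 0 by case: (ht e).
rewrite !ge0_sume_distrr; last 2 first.
- move=> e Pe; rewrite mule_ge0 ?simplex_area_ge0// lee_fin detZ; have := pd _ Pe => hh.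
  by rewrite ltW// mulr_gt0// nmulr_rgt0.
- move=> e Pe; rewrite mule_ge0 ?simplex_area_ge0// lee_fin detZ; have := pd _ Pe => hh.
  by rewrite ltW// !mulr_gt0.
rewrite -big_split /=; apply: lee_sum => e Pe.
have hh := pd _ Pe.
have P1 : 0 < s e.1 * s e.2 by rewrite mulr_gt0.
have P2 : 0 < t e.1 * t e.2 by rewrite nmulr_rgt0.
rewrite !muleA -!EFinM -ge0_muleDl ?lee_fin ?detZ; last 2 first.
- by rewrite !mulr_ge0// ltW.
- by rewrite mulr_ge0// mulr_ge0// ltW.
apply: lee_wpmul2r; first exact: simplex_area_ge0.
rewrite -EFinD lee_fin !mulrA -mulrDl -!mulrA ler_peMl//; first exact: ltW.
Qed.

(* The last hypothesis says that [H] lies in [(1 + ep)] times the convex hull of the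
points, expressed through its supporting half-planes. *)
Lemma fan_cover (H : set plane) (ep : R) : measurable H ->
  (forall i, x i != (0, 0)) -> 0 < ep ->
  (forall z, z.1 != 0 -> z.2 != 0 ->
      exists i j, 0 < det (x i) (x j) /\ in_cone (x i) (x j) z) ->
  (forall f1 f2 D : R, 0 < D -> (forall i, f1 * (x i).1 + f2 * (x i).2 <= D) ->
    forall z, H z -> f1 * z.1 + f2 * z.2 <= (1 + ep) * D) ->
  (Area H <= ((1 + ep) ^+ 2)%:E * \sum_(e | edge x e.1 e.2) (det (x e.1) (x e.2))%:E *
      simplex_area R)%E.
Proof.
move=> mH x0 ep0 quad net.
pose Tz e := tri (pscale (1 + ep) (x e.1)) (pscale (1 + ep) (x e.2)) : set plane.
pose U := \big[setU/set0]_(e <- index_enum _ | edge x e.1 e.2) Tz e.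
(* The lines through 0 in these directions are discarded as a null set: [edge_cover] wants [z] off
   the lines of the vertices, and the cone hypothesis wants it off the axes. *)
pose ax : seq (R * R) := (1, 0) :: (0, 1) :: [seq x i | i <- enum I].
pose line v : set plane := [set z | det v z = 0].
pose V := \big[setU/set0]_(v <- ax) line v.
have ax0 v : v \in ax -> v != (0, 0).
  rewrite !inE => /or3P[/eqP->|/eqP->|/mapP[i _ ->]]; last exact: x0.
    by rewrite xpair_eqE oner_eq0.
  by rewrite xpair_eqE oner_eq0 andbF.
have mT e : measurable (Tz e) by exact: measurable_tri.
have ml v : measurable (line v) by exact: measurable_line.
have mU : measurable U by apply: bigsetU_measurable.
have mV : measurable V by apply: bigsetU_measurable.
have UE : U = \bigcup_(e in [set e | (e \in index_enum _) && edge x e.1 e.2]) Tz e.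
  by rewrite /U -bigcup_seq_cond.
have VE : V = \bigcup_(v in [set` ax]) line v by rewrite /V -bigcup_seq.
have HUV : H `<=` U `|` V.
  move=> z Hz; have [gen|ngen] := pselect (forall v, v \in ax -> det v z != 0); last first.
    right; move/existsNP : ngen => [v /not_implyP[vax /negP/negPn/eqP vz]].
    by rewrite VE; exists v.
  left.
  have z1 : z.1 != 0.
    have := gen (0, 1); rewrite /det /= !inE eqxx orbT => /(_ isT).
    by rewrite mul0r mul1r sub0r oppr_eq0.
  have z2 : z.2 != 0.
    have := gen (1, 0); rewrite /det /= !inE eqxx => /(_ isT).
    by rewrite mul0r mul1r subr0.
  have gx k : det (x k) z != 0 by apply: gen; rewrite !inE map_f ?orbT// mem_enum.
  have [i [j [Eij [a0 b0]]]] := edge_cover gx (quad z z1 z2).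
  rewrite UE; exists (i, j) => /=; first by rewrite mem_index_enum.
  have [D0 hE] := edgeP Eij.
  (* The half-plane fed to [net] is the one bounded by the line of the edge; it contains all the
     points by the edge condition. *)
  have key : det z (x j) + det (x i) z <= (1 + ep) * det (x i) (x j).
    have := net ((x j).2 - (x i).2) ((x i).1 - (x j).1) _ D0 _ z Hz.
    rewrite /det => h; rewrite [leLHS](_ : _ = ((x j).2 - (x i).2) * z.1 + ((x i).1 - (x
        j).1) * z.2); last by ring.
    by apply: h => k; have [+ _] := hE k; rewrite /det; lra.
  have e1 : 0 < 1 + ep by lra.
  have detr p q : det p (pscale (1 + ep) q) = (1 + ep) * det p q by rewrite /det /=; ring.
  have detl p q : det (pscale (1 + ep) p) q = (1 + ep) * det p q by rewrite /det /=; ring.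
  split; rewrite /= ?detr ?detl ?mulr_gt0//.
  by rewrite -mulrDr ler_pM2l.
apply: (le_trans (Area_le mH (measurableU _ _ mU mV) HUV)).
apply: (le_trans (@measureU2 _ _ _ area2 _ _ mU mV)).
have V0 : (area2 V <= 0)%E.
  apply: (le_trans (@le_measure_bigsetU _ _ _ area2 _ ax xpredT line ml)).
  rewrite big_seq big1//; move=> v /ax0 v0; exact: Area_line.
apply: (le_trans (leeD2l (area2 U) V0)).
rewrite adde0; apply: (le_trans (@le_measure_bigsetU _ _ _ area2 _ _ _ _ mT)).
rewrite ge0_sume_distrr; last first.
  by move=> e /edgeP[D0 _]; rewrite mule_ge0 ?simplex_area_ge0// lee_fin ltW.
apply: lee_sum => e /edgeP[D0 _].
have e1 : 0 < 1 + ep by lra.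
have De : det (pscale (1 + ep) (x e.1)) (pscale (1 + ep) (x e.2)) = (1 + ep) ^+ 2 * det (x
    e.1) (x e.2).
  by rewrite /det /=; ring.
rewrite [leLHS](_ : _ = Area (Tz e))// Area_tri De; first by rewrite EFinM muleA.
by rewrite mulr_gt0// exprn_gt0.
Qed.
End FanArea.

(** * Convex hulls *)

Section Hulls.
Variable R : realType.
Notation plane := (measurableTypeR R * measurableTypeR R)%type.
Notation pt := (R * R)%type.
Implicit Types A B P Q L : set pt.

Lemma hull_join_min A B C : convex_set2 C -> A `<=` C -> B `<=` C -> hull_join A B `<=` C.
Proof. by move=> cC AC BC z /(_ C); apply; split=> // y [/AC|/BC]. Qed.

Lemma hull_join_convex A B : convex_set2 (hull_join A B).
Proof.
move=> a b ha hb t h0' t1 C hC; have [cC _] := hC.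
by apply: cC => //; [exact: ha|exact: hb].
Qed.

Lemma hull_join_subl A B : A `<=` hull_join A B.
Proof. by move=> z Az C [_]; apply; left. Qed.

Lemma hull_join_subr A B : B `<=` hull_join A B.
Proof. by move=> z Bz C [_]; apply; right. Qed.

(** The conclusion is free of division, so both weights may vanish; in [hull_join_segs] this happens
    at the endpoints of segments. *)
Lemma convex_comb P (p q : pt) (a b : R) : convex_set2 P -> P p -> P q ->
    0 <= a -> 0 <= b ->
  exists r, [/\ P r, a * p.1 + b * q.1 = (a + b) * r.1 & a * p.2 + b * q.2 = (a + b) * r.2].
Proof.
move=> cP Pp Pq a0 b0; have [ab0|ab0] := eqVneq (a + b) 0.
  have -> : a = 0 by lra.
  have -> : b = 0 by lra.
  by exists p; split => //; rewrite addr0 !mul0r addr0.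
have ab : 0 < a + b by rewrite lt0r ab0 addr_ge0.
exists (padd (pscale (1 - b / (a + b)) p) (pscale (b / (a + b)) q)); split => /=;
    last 2 first.
- by field.
- by field.
by apply: cP => //; [rewrite divr_ge0// ltW|rewrite ler_pdivrMr// mul1r lerDr].
Qed.

(** The union of the segments from [P] to [Q], written as a continuous image of a product with the
    unit interval so that compactness is inherited. *)
Definition segs (P Q : set pt) : set pt :=
  (fun z : pt * pt * R => padd (pscale (1 - z.2) z.1.1) (pscale z.2 z.1.2)) @`
     ((P `*` Q) `*` `[0, 1]%classic).

Lemma hull_join_segs P Q : convex_set2 P -> convex_set2 Q -> P !=set0 -> Q !=set0 ->
  hull_join P Q = segs P Q.
Proof.
move=> cP cQ [p0 Pp0] [q0 Qq0]; apply/seteqP; split; last first.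
  move=> _ [[[p q] t] /= [[Pp Qq]] + <-]; rewrite in_itv /= => /andP[h0 h1].
  by apply: hull_join_convex => //; [exact: hull_join_subl|exact: hull_join_subr].
apply: hull_join_min.
(* In a combination of two such points, the parts in [P] and the parts in [Q] are merged separately,
   which leaves a point of one segment. *)
- move=> _ _ [[[p q] t] /= [[Pp Qq]] + <-] [[[p' q'] t'] /= [[Pp' Qq']] + <-].
  rewrite !in_itv /= => /andP[h0 h1] /andP[h0' h1'] s s0 s1.
  have [||r [Pr r1 r2]] := @convex_comb P p p' ((1 - s) * (1 - t)) (s * (1 - t')) cP Pp Pp'.
  + by rewrite mulr_ge0//; lra.
  + by rewrite mulr_ge0//; lra.
  have [||u [Qu u1 u2]] := @convex_comb Q q q' ((1 - s) * t) (s * t') cQ Qq Qq'.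
  + by rewrite mulr_ge0//; lra.
  + by rewrite mulr_ge0//; lra.
  have [g0 g1] : 0 <= (1 - s) * t + s * t' /\ (1 - s) * t + s * t' <= 1.
    by split; nra.
  exists (r, u, (1 - s) * t + s * t') => /=.
    by split => //; rewrite in_itv /= g0 g1.
  have e : 1 - ((1 - s) * t + s * t') = (1 - s) * (1 - t) + s * (1 - t') by ring.
  by apply: pairP => /=; rewrite e -?r1 -?r2 -?u1 -?u2; ring.
- move=> p Pp; exists (p, q0, 0) => /=; first by rewrite in_itv /= lexx ler01.
  by apply: pairP => /=; rewrite subr0 mul1r mul0r addr0.
- move=> q Qq; exists (p0, q, 1) => /=; first by rewrite in_itv /= lexx ler01.
  by apply: pairP => /=; rewrite subrr mul1r mul0r add0r.
Qed.

Lemma continuous_pair (T : topologicalType) (f g : T -> R) :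
  continuous f -> continuous g -> continuous (fun z => (f z, g z)).
Proof. move=> cf cg z; exact: (@cvg_pair _ _ _ (nbhs z) (nbhs (f z)) (nbhs (g z)) _ _ _ f
    g (cf z) (cg z)). Qed.

Lemma hull_join_compact P Q : convex_set2 P -> convex_set2 Q -> P !=set0 -> Q !=set0 ->
  compact P -> compact Q -> compact (hull_join P Q).
Proof.
move=> cP cQ P0 Q0 kP kQ; rewrite hull_join_segs//.
apply: continuous_compact; last first.
  by apply: compact_setX; [exact: compact_setX|exact: segment_compact].
apply: continuous_subspaceT.
have c1 : continuous (fun z : pt * pt * R => z.1.1) by move=> z; apply: cvg_comp;
    exact: cvg_fst.
have c2 : continuous (fun z : pt * pt * R => z.1.2).
  by move=> z; apply: cvg_comp; [exact: cvg_fst|exact: cvg_snd].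
have c3 : continuous (fun z : pt * pt * R => z.2) by move=> z; exact: cvg_snd.
have ca : continuous (fun z : pt * pt * R => (1 - z.2) * z.1.1.1 + z.2 * z.1.2.1).
  move=> z; apply: cvgD; apply: cvgM; try exact: c3.
  - by apply: cvgB; [exact: cvg_cst|exact: c3].
  - by apply: cvg_comp (c1 z) _; exact: cvg_fst.
  - by apply: cvg_comp (c2 z) _; exact: cvg_fst.
have cb : continuous (fun z : pt * pt * R => (1 - z.2) * z.1.1.2 + z.2 * z.1.2.2).
  move=> z; apply: cvgD; apply: cvgM; try exact: c3.
  - by apply: cvgB; [exact: cvg_cst|exact: c3].
  - by apply: cvg_comp (c1 z) _; exact: cvg_snd.
  - by apply: cvg_comp (c2 z) _; exact: cvg_snd.
exact: (continuous_pair ca cb).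
Qed.

Lemma affine_compact (c : R) (v : pt) P : compact P ->
  compact ((fun p => padd v (pscale c p)) @` P).
Proof.
move=> kP; apply: continuous_compact => //; apply: continuous_subspaceT.
have ca : continuous (fun z : pt => v.1 + c * z.1).
  by move=> z; apply: cvgD; [exact: cvg_cst|apply: cvgM; [exact: cvg_cst|exact: cvg_fst]].
have cb : continuous (fun z : pt => v.2 + c * z.2).
  by move=> z; apply: cvgD; [exact: cvg_cst|apply: cvgM; [exact: cvg_cst|exact: cvg_snd]].
exact: (continuous_pair ca cb).
Qed.

Lemma finite_net L (dl : R) : compact L -> 0 < dl -> exists s : seq pt,
  (forall q, q \in s -> L q) /\
  (forall p, L p -> exists q, [/\ q \in s, `|p.1 - q.1| <= dl & `|p.2 - q.2| <= dl]).
Proof.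
move=> Lc d0.
pose T : ptopologicalType :=
  HB.pack (R * R)%type (Pointed.on (R * R)%type) (Topological.on (R * R)%type).
have : @cover_compact T L by rewrite -(@compact_cover T); exact: Lc.
move=> /(_ _ L (fun q => (ball q dl)°)) [].
- by move=> q _; exact: open_interior.
- by move=> p Lp; exists p => //; apply: nbhsx_ballx.
move=> D DL cov; exists (finmap.enum_fset D); split.
  by move=> q qD; have := DL q qD; rewrite inE.
move=> p /cov [q qD /interior_subset [h1 h2]]; exists q; split => //.
  by move: h1; rewrite /ball /= distrC => /ltW.
by move: h2; rewrite /ball /= distrC => /ltW.
Qed.

End Hulls.

(** * Upper bound for the hull *)

Section Middle.
Variable R : realType.
Notation plane := (measurableTypeR R * measurableTypeR R)%type.
Notation pt := (R * R)%type.
Implicit Types L : set pt.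

Lemma scale_compact (c : R) L : compact L -> compact (scale_set c L).
Proof.
move=> kL; rewrite (_ : scale_set c L = (fun p => padd (0, 0) (pscale c p)) @` L);
    first exact: affine_compact.
by apply: eq_imagel => p _; apply: pairP; rewrite /= add0r.
Qed.

Lemma scale_convex (c : R) L : convex_set2 L -> convex_set2 (scale_set c L).
Proof.
move=> cL _ _ [p Lp <-] [q Lq <-] t h0 h1.
exists (padd (pscale (1 - t) p) (pscale t q)); first exact: cL.
by apply: pairP => /=; ring.
Qed.

Lemma translate_compact (v : pt) L : compact L -> compact (translate v L).
Proof.
move=> kL; rewrite (_ : translate v L = (fun p => padd v (pscale 1 p)) @` L);
    first exact: affine_compact.
by apply: eq_imagel => p _; apply: pairP; rewrite /= mul1r.
Qed.

Lemma translate_convex (v : pt) L : convex_set2 L -> convex_set2 (translate v L).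
Proof.
move=> cL _ _ [p Lp <-] [q Lq <-] t h0 h1.
exists (padd (pscale (1 - t) p) (pscale t q)); first exact: cL.
by apply: pairP => /=; ring.
Qed.

Lemma le_sq_eps (h c : R) : 0 <= c -> (forall e, 0 < e -> h <= (1 + e) ^+ 2 * c) -> h <= c.
Proof.
move=> c0 H; rewrite leNgt; apply/negP => ch.
(* For [e <= 1] the excess [(2 + e) * e * c] is at most [3 * e * c], which this choice keeps below
   [h - c]. *)
pose e := Num.min 1 ((h - c) / (4 * (c + 1))).
have k0 : 0 < (h - c) / (4 * (c + 1)) by rewrite divr_gt0//; lra.
have e0 : 0 < e by rewrite lt_min ltr01 k0.
have e1 : e <= 1 by rewrite ge_min lexx.
have e2 : e * (4 * (c + 1)) <= h - c.
  by rewrite -ler_pdivlMr; [rewrite ge_min lexx orbT|lra].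
have := H e e0; rewrite (_ : (1 + e) ^+ 2 * c = c + (2 + e) * e * c); last by ring.
have : (2 + e) * e * c <= 3 * e * c by rewrite ler_wpM2r// ler_wpM2r//; [exact: ltW|lra].
have : 0 <= e * c by rewrite mulr_ge0// ltW.
lra.
Qed.

(** The four axis points make 0 interior in a quantitative way: they provide a fan triangle in each
    quadrant, and they bound the coefficients of supporting functionals, which turns the absolute
    error of a net into the relative error [e]. *)
Lemma hull_area_mid L (lam r : R) : compact L -> convex_set2 L ->
  0 < r -> L (r, 0) -> L (- r, 0) -> L (0, r) -> L (0, - r) ->
  (forall p, L p -> L (pscale (- 2^-1) p)) -> 3^-1 <= lam -> lam <= 2 / 3 ->
  (Area (hull_join (scale_set (1 - lam) L) (scale_set (- lam) L)) <=
   (2 * lam * (1 - lam))%:E * Area L)%E.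
Proof.
move=> kL cL r0 L1 L2 L3 L4 half l1 l2.
set mu := 1 - lam; set H := hull_join _ _.
have lam0 : 0 < lam by lra.
have mu0 : 0 < mu by rewrite /mu; lra.
have L0 : L (0, 0).
  have := cL _ _ L1 L2 2^-1; have h0 : (0 : R) <= 2^-1 by lra.
  have h1 : (2^-1 : R) <= 1 by lra.
  by move=> /(_ h0 h1); congr L; apply: pairP => /=; field.
have kH : compact H.
  apply: hull_join_compact; try exact: scale_convex; try exact: scale_compact.
  - by exists (pscale mu (0, 0)); exists (0, 0).
  - by exists (pscale (- lam) (0, 0)); exists (0, 0).
have mL : measurable (L : set plane) by exact: compact_measurable2.
have mH : measurable (H : set plane) by exact: compact_measurable2.
have fL : Area L \is a fin_num by rewrite ge0_fin_numE ?compact_Area_lty//;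
    exact: (measure_ge0 (@area2 R)).
have fH : Area H \is a fin_num by rewrite ge0_fin_numE ?compact_Area_lty//;
    exact: (measure_ge0 (@area2 R)).
have aL0 : 0 <= fine (Area L) by apply: fine_ge0; exact: (measure_ge0 (@area2 R)).
rewrite -(fineK fL) -(fineK fH) -EFinM lee_fin.
apply: le_sq_eps; first by rewrite !mulr_ge0//; lra.
move=> e e0.
rewrite -lee_fin EFinM (EFinM (2 * lam * mu)) (fineK fL) (fineK fH).
(* A functional that is at most [D] on the vertices has coefficients at most [D / (mu * r)]. A mesh
   of [e * r / 4] then costs at most [D * e / 2] on [mu L], and at most [D * e] on [- lam L] because
   [lam <= 2 * mu]. *)
have d0 : 0 < e * r / 4 by rewrite divr_gt0 ?mulr_gt0.
have [s [sL snet]] := finite_net kL d0.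
pose X0 : seq pt := [:: (mu * r, 0); (- (mu * r), 0); (0, mu * r); (0, - (mu * r))] ++
   [seq pscale mu p | p <- s] ++ [seq pscale (- lam) p | p <- s].
pose X : seq pt := [seq v <- X0 | v != (0, 0)].
pose x (i : seq_sub X) : pt := ssval i.
have xinj : injective x by exact: val_inj.
have X0P v : v \in X0 -> exists p, L p /\ (v = pscale mu p \/ v = pscale (- lam) p).
  rewrite !mem_cat !inE => /or3P[/or4P[]/eqP->|/mapP[p ps ->]|/mapP[p ps ->]].
  - by exists (r, 0); split => //; left; apply: pairP => /=; ring.
  - by exists (- r, 0); split => //; left; apply: pairP => /=; ring.
  - by exists (0, r); split => //; left; apply: pairP => /=; ring.
  - by exists (0, - r); split => //; left; apply: pairP => /=; ring.
  - by exists p; split; [exact: sL|left].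
  - by exists p; split; [exact: sL|right].
(* A vertex may have both forms; either pair of factors will do, since [ieq] covers all
   combinations. *)
have typ (i : seq_sub X) : exists st : R * R,
    [/\ st = (mu^-1, - (2 * mu)^-1) \/ st = ((2 * lam)^-1, - lam^-1),
     L (pscale st.1 (x i)) & L (pscale st.2 (x i))].
  have /X0P[p [Lp [xp|xp]]] : x i \in X0 by have := ssvalP i; rewrite mem_filter => /andP[].
  - exists (mu^-1, - (2 * mu)^-1); rewrite xp; split; first by left.
    + by move: (Lp); congr L; apply: pairP => /=; field; lra.
    + by move: (half _ Lp); congr L; apply: pairP => /=; field; lra.
  - exists ((2 * lam)^-1, - lam^-1); rewrite xp; split; first by right.
    + by move: (half _ Lp); congr L; apply: pairP => /=; field; lra.
    + by move: (Lp); congr L; apply: pairP => /=; field; lra.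
have [st stP] := choice typ.
(* [A + B = 2 * lam * mu], and [A], [B] make the inequality below an equality for
pairs of vertices from [mu L] and for mixed pairs. *)
pose A := 2 * mu * (2 * mu - lam) / 3; pose B := 4 * mu * (2 * lam - mu) / 3.
have ieq i j : 1 <= A * ((st i).1 * (st j).1) + B * ((st i).2 * (st j).2).
  case: (stP i) => si _ _; case: (stP j) => sj _ _.
  case: si => ->; case: sj => -> /=.
  - rewrite [leRHS](_ : _ = 1)// /A /B; field; lra.
  - rewrite [leRHS](_ : _ = 1)// /A /B; field; lra.
  - rewrite [leRHS](_ : _ = 1)// /A /B; field; lra.
  (* The slack is [(2 - 3 * lam) * (3 * lam - 1) / (2 * lam ^+ 2)], non-negative exactly in the
     middle range. *)
  - rewrite [leRHS](_ : _ = 1 + (2 * mu - lam) * (2 * lam - mu) / (2 * lam ^+ 2));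
      last by rewrite /A /B; field; lra.
    rewrite lerDl divr_ge0// ?mulr_ge0 ?sqr_ge0//; rewrite /mu; lra.
have FB : (\sum_(e | edge x e.1 e.2) (det (x e.1) (x e.2))%:E * simplex_area R <= (A +
    B)%:E * Area L)%E.
  apply: (@fan_bound _ _ x (fun i => (st i).1) (fun i => (st i).2) A B L) => //.
  - move=> i; case: (stP i) => si L1' _; split => //.
    by case: si => -> /=; rewrite invr_gt0//; lra.
  - move=> i; case: (stP i) => si _ L2'; split => //.
    by case: si => -> /=; rewrite oppr_lt0 invr_gt0//; lra.
  - by rewrite /A divr_ge0// !mulr_ge0//; rewrite /mu; lra.
  - by rewrite /B divr_ge0// !mulr_ge0//; rewrite /mu; lra.
have AB : A + B = 2 * lam * mu by rewrite /A /B; field.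
rewrite -AB; apply: le_trans; last first.
  apply: lee_wpmul2l; last exact: FB.
  by rewrite lee_fin sqr_ge0.
have inX v : v \in X0 -> v != (0, 0) -> exists i, x i = v.
  move=> vX v0; have vX' : v \in X by rewrite mem_filter v0.
  by exists (SeqSub vX').
have mur0 : mu * r != 0 by rewrite gt_eqF// mulr_gt0.
have mur : 0 < mu * r by rewrite mulr_gt0.
have [i1 x1] : exists i, x i = (mu * r, 0).
  by apply: inX; rewrite ?inE ?eqxx// xpair_eqE (negbTE mur0).
have [i2 x2] : exists i, x i = (- (mu * r), 0).
  by apply: inX; rewrite ?inE ?eqxx ?orbT// xpair_eqE oppr_eq0 (negbTE mur0).
have [i3 x3] : exists i, x i = (0, mu * r).
  by apply: inX; rewrite ?inE ?eqxx ?orbT// xpair_eqE (negbTE mur0) andbF.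
have [i4 x4] : exists i, x i = (0, - (mu * r)).
  by apply: inX; rewrite ?inE ?eqxx ?orbT// xpair_eqE oppr_eq0 (negbTE mur0) andbF.
apply: fan_cover => //.
- by move=> i; have := ssvalP i; rewrite mem_filter => /andP[].
- move=> z z1 z2; have mm : 0 < mu * r * (mu * r) by rewrite mulr_gt0.
  have pp (a : R) : 0 < a -> 0 < mu * r * a by move=> a0; rewrite mulr_gt0.
  case: (ltgtP z.1 0) z1 => // z1 _; case: (ltgtP z.2 0) z2 => // z2 _.
  + by exists i2, i4; rewrite x2 x4 /in_cone /det /=; have := pp (- z.1);
      have := pp (- z.2); repeat split; lra.
  + by exists i3, i2; rewrite x2 x3 /in_cone /det /=; have := pp (- z.1);
      have := pp (z.2); repeat split; lra.
  + by exists i4, i1; rewrite x1 x4 /in_cone /det /=; have := pp (z.1);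
      have := pp (- z.2); repeat split; lra.
  + by exists i1, i3; rewrite x1 x3 /in_cone /det /=; have := pp (z.1); have := pp (z.2);
      repeat split; lra.
- move=> f1 f2 D D0 fX.
  have fX0 v : v \in X0 -> f1 * v.1 + f2 * v.2 <= D.
    move=> vX; have [->|v0] := eqVneq v (0, 0); first by rewrite /= !mulr0 addr0 ltW.
    by have [i <-] := inX _ vX v0; exact: fX.
  have b1 : `|f1| * (mu * r) <= D.
    rewrite -[mu * r in leLHS]gtr0_norm// -normrM ler_norml.
    by have := fX i1; have := fX i2; rewrite x1 x2 /=; lra.
  have b2 : `|f2| * (mu * r) <= D.
    rewrite -[mu * r in leLHS]gtr0_norm// -normrM ler_norml.
    by have := fX i3; have := fX i4; rewrite x3 x4 /=; lra.
  have dev (p q : pt) : `|p.1 - q.1| <= e * r / 4 -> `|p.2 - q.2| <= e * r / 4 ->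
      mu * `|f1 * (p.1 - q.1) + f2 * (p.2 - q.2)| <= D * e / 2.
    move=> h1 h2.
    have : `|f1 * (p.1 - q.1) + f2 * (p.2 - q.2)| <= (`|f1| + `|f2|) * (e * r / 4).
      by rewrite (le_trans (ler_normD _ _))// !normrM mulrDl lerD// ler_wpM2l.
    move=> h; apply: (le_trans (ler_wpM2l (ltW mu0) h)).
    rewrite [leLHS](_ : _ = (`|f1| * (mu * r) + `|f2| * (mu * r)) * e / 4); last by field.
    rewrite [leRHS](_ : _ = (D + D) * e / 4); last by field.
    by rewrite ler_pM2r// ler_pM2r// lerD.
  have dev' (p q : pt) : `|p.1 - q.1| <= e * r / 4 -> `|p.2 - q.2| <= e * r / 4 ->
      `|mu * (f1 * (p.1 - q.1) + f2 * (p.2 - q.2))| <= D * e /\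
      `|lam * (f1 * (p.1 - q.1) + f2 * (p.2 - q.2))| <= D * e.
    move=> h1 h2; have := dev _ _ h1 h2; rewrite !normrM (gtr0_norm mu0) (gtr0_norm lam0).
    set w := `|_|; have w0 : 0 <= w by rewrite /w.
    have De : 0 < D * e by rewrite mulr_gt0.
    move=> hw; split; first by lra.
    have : lam * w <= 2 * mu * w by rewrite ler_wpM2r//; rewrite /mu; lra.
    by lra.
  (* A half-plane is convex, so only points of the two scaled copies of [L] have to be compared with
     the net. *)
  pose Cf : set pt := [set z | f1 * z.1 + f2 * z.2 <= (1 + e) * D].
  have cCf : convex_set2 Cf.
    move=> a b; rewrite /Cf /= => ha hb t h0 h1.
    have h1' : 0 <= 1 - t by lra.
    have := ler_wpM2l h1' ha; have := ler_wpM2l h0 hb; lra.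
  apply: hull_join_min => //.
  + move=> _ [p Lp <-]; have [q [qs h1 h2]] := snet p Lp.
    have [+ _] := dev' _ _ h1 h2; rewrite ler_norml => /andP[_ hh].
    have := fX0 (pscale mu q); rewrite !mem_cat map_f//= orbT => /(_ isT).
    by rewrite /Cf /=; lra.
  + move=> _ [p Lp <-]; have [q [qs h1 h2]] := snet p Lp.
    have [_ +] := dev' _ _ h1 h2; rewrite ler_norml => /andP[hh _].
    have := fX0 (pscale (- lam) q);
        rewrite !mem_cat (map_f (pscale (- lam)))//= !orbT => /(_ isT).
    by rewrite /Cf /=; lra.
Qed.
End Middle.

(** * The centroid *)

Section Centroid.
Variable R : realType.
Notation plane := (measurableTypeR R * measurableTypeR R)%type.
Notation pt := (R * R)%type.
Notation area2 := (@area2 R).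
Implicit Types K : set pt.

Lemma compact_lin_integrable K (a b c : R) : compact K ->
  area2.-integrable (K : set plane) (EFin \o (fun p : plane => a * p.1 + b * p.2 + c)).
Proof.
move=> kK; have mK := compact_measurable2 kK.
apply: measurable_bounded_integrable => //.
- exact: compact_Area_lty.
- by apply: measurable_funTS; exact: measurable_lin.
have [M M0 hM] := compact_bounded2 kK.
exists (`|a| * M + `|b| * M + `|c|); split; first by rewrite num_real.
move=> N /ltW hN p /hM [h1 h2] /=; apply: le_trans hN.
apply: le_trans (ler_normD _ _) _; rewrite lerD2r.
by apply: le_trans (ler_normD _ _) _; rewrite !normrM lerD// ler_wpM2l.
Qed.

Definition homothety (p : pt) (t : R) (z : pt) : pt :=
  (p.1 + t * (z.1 - p.1), p.2 + t * (z.2 - p.2)).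

Lemma Area_homothety (u v t : R) (B : set plane) : 0 < t -> measurable B ->
  Area B = ((t ^+ 2)%:E *
    Area ((fun z : pt => (t * z.1 + 0 * z.2 + u, 0 * z.1 + t * z.2 + v)%R) @^-1` B))%E.
Proof.
move=> t0 mB; have D0 : t * t - 0 * 0 != 0 by rewrite mul0r subr0 mulf_neq0// gt_eqF.
rewrite Area_affine// mul0r subr0 muleA -EFinM gtr0_norm ?mulr_gt0// -expr2 divff ?mul1e//.
by rewrite expf_neq0// gt_eqF.
Qed.

(** Area is [t ^+ 2] times its push-forward under the homothety, so the integral can be transported;
    the sign condition gives access to the transfer formula for non-negative integrands. *)
Lemma homothety_integral K (p : pt) (a b c t : R) : compact K -> 0 < t ->
  (forall z, K z -> 0 <= a * (homothety p t z).1 + b * (homothety p t z).2 + c) ->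
  (\int[area2]_(z in homothety p t @` K) (a * z.1 + b * z.2 + c)%:E =
   (t ^+ 2)%:E *
   \int[area2]_(z in K) (a * (homothety p t z).1 + b * (homothety p t z).2 + c)%:E)%E.
Proof.
move=> kK t0 pos; set phi := homothety p t.
have t0' : t != 0 by rewrite gt_eqF.
pose psi (z : plane) : plane := (t * z.1 + 0 * z.2 + (1 - t) * p.1, 0 * z.1 + t * z.2 + (1
    - t) * p.2).
have phipsi : phi = psi :> (pt -> pt).
  by apply/funext => z; apply: pairP => /=; ring.
have mpsi : measurable_fun [set: plane] psi by apply: measurable_fun_pair;
    exact: measurable_lin.
have mK : measurable (K : set plane) := compact_measurable2 kK.
have kD : compact (phi @` K).
  rewrite (_ : phi = (fun z => padd ((1 - t) * p.1, (1 - t) * p.2) (pscale t z)));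
      first exact: affine_compact.
  by apply/funext => z; apply: pairP => /=; ring.
have mD : measurable (phi @` K : set plane) := compact_measurable2 kD.
have preK : psi @^-1` (phi @` K) = K.
  apply/seteqP; split => z; rewrite /preimage /mkset -phipsi; last by exists z.
  move=> [w Kw [/addrI/(mulfI t0')/addIr e1 /addrI/(mulfI t0')/addIr e2]].
  by rewrite (pairP (esym e1) (esym e2)).
have mf : measurable_fun (phi @` K : set plane) (fun z : plane =>
    (a * z.1 + b * z.2 + c)%:E).
  by apply: measurable_funTS; apply/measurable_EFinP; exact: measurable_lin.
have t2 : 0 <= t ^+ 2 by rewrite sqr_ge0.
have := @ge0_integral_pushforward _ _ _ _ _ psi mpsi area2 (phi @` K) (fun z : plane =>
    (a * z.1 + b * z.2 + c)%:E) mD mf.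
have pos' : {in (phi @` K : set plane), forall y : plane, (0 <= (a * y.1 + b * y.2 +
    c)%:E)%E}.
  by move=> y; rewrite inE => -[z Kz <-]; rewrite lee_fin; exact: pos.
move=> /(_ pos'); rewrite preK => E.
pose k : {nonneg R} := NngNum t2.
pose pm : {measure set plane -> \bar R} :=
  measure_function_pushforward__canonical__measure_function_Measure area2 mpsi.
transitivity (\int[mscale k pm]_(z in phi @` K) (a * z.1 + b * z.2 + c)%:E)%E.
  apply: eq_measure_integral => B mB _.
  exact: (@Area_homothety ((1 - t) * p.1) ((1 - t) * p.2) t B t0 mB).
have pos2 y : (phi @` K) y -> (0 <= (a * y.1 + b * y.2 + c)%:E)%E.
  by move=> Dy; apply: pos'; rewrite inE.
rewrite (@ge0_integral_mscale _ _ _ _ _ mD k _ mf pos2).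
have F : (\int[area2]_(z in K) (a * (phi z).1 + b * (phi z).2 + c)%:E =
    \int[area2]_(x in K) ((fun z : plane => (a * z.1 + b * z.2 + c)%:E) \o psi) x)%E.
  by apply: eq_integral => z _; rewrite phipsi.
rewrite F -E; reflexivity.
Qed.

(* For the homothety [phi] of centre [p] and ratio [t < 1], [phi K] lies in [K], so that
the integral over [K] is at least that over [phi K], which is
[t ^ 2 * ((1 - t) * h p * |K| + t * I)]; then let [t] tend to 1. *)
Lemma integral_affine_ge K (p : pt) (a b c : R) : compact K -> convex_set2 K -> K p ->
  (forall z, K z -> 0 <= a * z.1 + b * z.2 + c) ->
  (a * p.1 + b * p.2 + c) * fine (Area K) <=
  3 * Rintegral area2 K (fun z => a * z.1 + b * z.2 + c).
Proof.
move=> kK cK Kp pos.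
have mK : measurable (K : set plane) := compact_measurable2 kK.
set h := (fun z : plane => _); set hp := _ + c; set A := fine (Area K).
set I := Rintegral area2 K h.
have hp0 : 0 <= hp by exact: pos.
have A0 : 0 <= A by apply: fine_ge0; exact: (measure_ge0 area2).
have I0 : 0 <= I by apply: Rintegral_ge0 => z Kz; exact: pos.
(* The factor on the right is [(1 - t ^+ 3) / (1 - t)]: the term [t ^+ 3 * I] is moved across and
   [1 - t] is cancelled. *)
have step t : 0 < t -> t < 1 -> t ^+ 2 * (hp * A) <= (1 + t + t ^+ 2) * I.
  move=> t0 t1.
  pose phi := homothety p t.
  have phiK z : K z -> K (phi z).
    move=> Kz; have := cK _ _ Kp Kz t (ltW t0) (ltW t1); congr K.
    by apply: pairP => /=; ring.
  have hphi z : h (phi z) = (1 - t) * hp + t * h z by rewrite /h /hp /phi /=; ring.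
  have kD : compact (phi @` K).
    rewrite (_ : phi = (fun z => padd ((1 - t) * p.1, (1 - t) * p.2) (pscale t z)));
        first exact: affine_compact.
    by apply/funext => z; apply: pairP => /=; ring.
  have HI := @homothety_integral K p a b c t kK t0 (fun z Kz => pos _ (phiK z Kz)).
  have mD : measurable (phi @` K : set plane) := compact_measurable2 kD.
  have DK : phi @` K `<=` K by move=> _ [z Kz <-]; exact: phiK.
  have mh D : measurable_fun (D : set plane) (EFin \o h).
    by apply: measurable_funTS; apply/measurable_EFinP; exact: measurable_lin.
  have le : (\int[area2]_(z in phi @` K) (h z)%:E <= \int[area2]_(z in K) (h z)%:E)%E.
    by apply: ge0_subset_integral.
  have inth : area2.-integrable K (EFin \o h) by exact: compact_lin_integrable.
  have IE : (\int[area2]_(z in K) (h z)%:E = I%:E)%E.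
    by rewrite /I /Rintegral fineK//; apply: integrable_fin_num.
  have J : (\int[area2]_(z in K) (h (phi z))%:E = ((1 - t) * hp * A + t * I)%:E)%E.
    have intphi : area2.-integrable K (EFin \o (fun z : plane => (1 - t) * hp + t * h z)).
      have := @compact_lin_integrable K (t * a) (t * b) ((1 - t) * hp + t * c) kK.
      by congr (integrable _ _ _); apply/funext => z /=; congr EFin; rewrite /h; ring.
    have -> : (\int[area2]_(z in K) (h (phi z))%:E = \int[area2]_(z in K) ((1 - t) * hp +
        t * h z)%:E)%E.
      by apply: eq_integral => z _; rewrite hphi.
    rewrite -[LHS]fineK; last by apply: integrable_fin_num.
    congr EFin; rewrite -/(Rintegral area2 K (fun z => (1 - t) * hp + t * h z)).
    have intc : area2.-integrable K (EFin \o (fun _ : plane => (1 - t) * hp)).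
      have := @compact_lin_integrable K 0 0 ((1 - t) * hp) kK.
      by congr (integrable _ _ _); apply/funext => z /=; congr EFin; ring.
    have intt : area2.-integrable K (EFin \o (fun z : plane => t * h z)).
      have := @compact_lin_integrable K (t * a) (t * b) (t * c) kK.
      by congr (integrable _ _ _); apply/funext => z /=; congr EFin; rewrite /h; ring.
    by rewrite RintegralD// Rintegral_cst// RintegralZl.
  move: le; rewrite HI IE J -EFinM lee_fin => le.
  have : (1 - t) * (t ^+ 2 * (hp * A)) <= (1 - t) * ((1 + t + t ^+ 2) * I).
    have -> : (1 - t) * ((1 + t + t ^+ 2) * I) = I - t ^+ 2 * (t * I) by ring.
    have -> : (1 - t) * (t ^+ 2 * (hp * A)) = t ^+ 2 * ((1 - t) * hp * A) by ring.
    by move: le; rewrite mulrDr; lra.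
  by rewrite ler_pM2l// subr_gt0.
rewrite leNgt; apply/negP => lt.
have hA : 0 < hp * A by lra.
(* With [t = 1 - s], the left side of [step] loses at most [2 * s * (hp * A)], that is at most half
   of the gap [hp * A - 3 * I], while the right side is at most [3 * I]. *)
pose s := Num.min (2^-1) ((hp * A - 3 * I) / (4 * (hp * A))).
have k0 : 0 < (hp * A - 3 * I) / (4 * (hp * A)) by rewrite divr_gt0//; lra.
have s0 : 0 < s by rewrite lt_min invr_gt0 ltr0n k0.
have s1 : s <= 2^-1 by rewrite ge_min lexx.
have s2 : s * (4 * (hp * A)) <= hp * A - 3 * I.
  by rewrite -ler_pdivlMr; [rewrite ge_min lexx orbT|lra].
have := step (1 - s).
have h1 : 0 < 1 - s by lra.
have h2 : 1 - s < 1 by lra.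
move=> /(_ h1 h2).
have -> : (1 - s) ^+ 2 * (hp * A) = hp * A - 2 * s * (hp * A) + s ^+ 2 * (hp * A) by ring.
have -> : (1 + (1 - s) + (1 - s) ^+ 2) * I = 3 * I - (3 - s) * s * I by ring.
have : 0 <= s ^+ 2 * (hp * A) by rewrite mulr_ge0 ?sqr_ge0// ltW.
have : 0 <= (3 - s) * s * I by rewrite !mulr_ge0//; lra.
lra.
Qed.

(** Let [k] be the point of [K] nearest to [q], and take the line through [k] normal to [k - q]. If
    some [z] in [K] were beyond it, a small step from [k] towards [z] would come closer to [q]. *)
Lemma separation K (q : pt) : compact K -> convex_set2 K -> K !=set0 -> ~ K q ->
  exists a b c : R,
    (forall z, K z -> 0 <= a * z.1 + b * z.2 + c) /\ a * q.1 + b * q.2 + c < 0.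
Proof.
move=> kK cK K0 nKq.
pose dd (z : pt) : R := (z.1 - q.1) * (z.1 - q.1) + (z.2 - q.2) * (z.2 - q.2).
have cdd : {within K, continuous dd}.
  have c1 : continuous (fun z : pt => z.1 - q.1).
    by move=> z; apply: cvgB; [exact: cvg_fst|exact: cvg_cst].
  have c2 : continuous (fun z : pt => z.2 - q.2).
    by move=> z; apply: cvgB; [exact: cvg_snd|exact: cvg_cst].
  apply: continuous_subspaceT => z.
  by apply: cvgD; apply: cvgM; (try exact: c1); exact: c2.
have [k kin kmin] := compact_EVT_min K0 kK cdd.
rewrite inE in kin.
exists (k.1 - q.1), (k.2 - q.2), (- ((k.1 - q.1) * k.1 + (k.2 - q.2) * k.2)); split.
  move=> z Kz; rewrite leNgt; apply/negP => neg.
  pose g := (k.1 - q.1) * (k.1 - z.1) + (k.2 - q.2) * (k.2 - z.2).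
  have g0 : 0 < g by rewrite /g; lra.
  pose N := (z.1 - k.1) ^+ 2 + (z.2 - k.2) ^+ 2.
  have N0 : 0 <= N by rewrite addr_ge0 ?sqr_ge0.
  (* The step changes the squared distance by [- t * (2 * g - t * N)], so [t] is taken with
     [t * N < 2 * g]. *)
  pose t := Num.min 1 (g / (N + 1)).
  have gN : 0 < g / (N + 1) by rewrite divr_gt0//; lra.
  have t0 : 0 < t by rewrite lt_min ltr01 gN.
  have t1 : t <= 1 by rewrite ge_min lexx.
  have t2 : t * (N + 1) <= g by rewrite -ler_pdivlMr; [rewrite ge_min lexx orbT|lra].
  have := kmin (padd (pscale (1 - t) k) (pscale t z)).
  rewrite inE => /(_ (cK _ _ kin Kz _ (ltW t0) t1)).
  have -> : dd (padd (pscale (1 - t) k) (pscale t z)) = dd k - t * (2 * g - t * N).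
    by rewrite /dd /g /N /=; ring.
  have : 0 < t * (2 * g - t * N) by rewrite mulr_gt0//; lra.
  lra.
have : 0 < (k.1 - q.1) ^+ 2 + (k.2 - q.2) ^+ 2.
  rewrite lt0r addr_ge0 ?sqr_ge0// andbT; apply/negP => /eqP e; apply: nKq.
  have e1 : (k.1 - q.1) ^+ 2 = 0 by have := sqr_ge0 (k.1 - q.1);
      have := sqr_ge0 (k.2 - q.2); lra.
  have e2 : (k.2 - q.2) ^+ 2 = 0 by lra.
  move/eqP: e1; rewrite sqrf_eq0 subr_eq0 => /eqP e1.
  move/eqP: e2; rewrite sqrf_eq0 subr_eq0 => /eqP e2.
  by rewrite -(pairP e1 e2).
lra.
Qed.

Lemma interior_box K p : (K°) p -> exists2 e : R, 0 < e &
  forall z, `|z.1 - p.1| < e -> `|z.2 - p.2| < e -> K z.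
Proof.
move=> /nbhs_ballP [e e0 he]; exists e => // z h1 h2; apply: he.
by split; rewrite /ball /= distrC.
Qed.

Lemma body_Area_gt0 K : compact K -> (K°) !=set0 -> 0 < fine (Area K).
Proof.
move=> kK [p /interior_box [e e0 he]].
have mK : measurable (K : set plane) := compact_measurable2 kK.
pose I := `]p.1 - e, p.1 + e[%classic : set (measurableTypeR R).
pose J := `]p.2 - e, p.2 + e[%classic : set (measurableTypeR R).
have mI : measurable I by exact: measurable_itv.
have mJ : measurable J by exact: measurable_itv.
have mIJ : measurable (I `*` J : set plane) by exact: measurableX.
have sub : I `*` J `<=` K.
  move=> z [/=]; rewrite /I /J /= !in_itv /= => h1 h2; apply: he; rewrite ltr_norml; lra.
have : (Area (I `*` J) <= Area K)%E by exact: Area_le mIJ mK sub.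
have -> : (Area (I `*` J) = lebesgue_measure I * lebesgue_measure J)%E by exact:
    product_measure1E.
rewrite /I /J !lebesgue_measure_itv /= !lte_fin !ifT; try lra.
rewrite -!EFinB -EFinM => h.
have fK : Area K \is a fin_num by rewrite ge0_fin_numE ?compact_Area_lty//;
    exact: (measure_ge0 area2).
move: h; rewrite -(fineK fK) lee_fin; apply: lt_le_trans.
by rewrite mulr_gt0//; lra.
Qed.

(** An affine [h], non-negative on [K], takes at this point the value [3 / 2] of [h] at the centroid
    minus half of [h] at [p]; this is non-negative by [integral_affine_ge], so no line separates the
    point from [K]. With the centroid at 0 the point is [- p / 2]. *)
Lemma centroid_half K p : compact K -> convex_set2 K -> 0 < fine (Area K) -> K p ->
  K (3 / 2 * (centroid K).1 - 2^-1 * p.1, 3 / 2 * (centroid K).2 - 2^-1 * p.2).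
Proof.
move=> kK cK A0 Kp; apply: contrapT => nK.
have [|a [b [c [pos neg]]]] := separation kK cK _ nK; first by exists p.
have mK : measurable (K : set plane) := compact_measurable2 kK.
have := integral_affine_ge kK cK Kp pos.
have -> : Rintegral area2 K (fun z => a * z.1 + b * z.2 + c) =
  (a * (centroid K).1 + b * (centroid K).2 + c) * fine (Area K).
  have i1 : area2.-integrable K (EFin \o (fun z : plane => z.1)).
    have := @compact_lin_integrable K 1 0 0 kK.
    by congr (integrable _ _ _); apply/funext => z /=; congr EFin; ring.
  have i2 : area2.-integrable K (EFin \o (fun z : plane => z.2)).
    have := @compact_lin_integrable K 0 1 0 kK.
    by congr (integrable _ _ _); apply/funext => z /=; congr EFin; ring.
  have i3 : area2.-integrable K (EFin \o (fun z : plane => a * z.1)).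
    have := @compact_lin_integrable K a 0 0 kK.
    by congr (integrable _ _ _); apply/funext => z /=; congr EFin; ring.
  have i4 : area2.-integrable K (EFin \o (fun z : plane => b * z.2)).
    have := @compact_lin_integrable K 0 b 0 kK.
    by congr (integrable _ _ _); apply/funext => z /=; congr EFin; ring.
  have i5 : area2.-integrable K (EFin \o (fun z : plane => a * z.1 + b * z.2)).
    have := @compact_lin_integrable K a b 0 kK.
    by congr (integrable _ _ _); apply/funext => z /=; congr EFin; ring.
  have i6 : area2.-integrable K (EFin \o (fun z : plane => c)).
    have := @compact_lin_integrable K 0 0 c kK.
    by congr (integrable _ _ _); apply/funext => z /=; congr EFin; ring.
  rewrite RintegralD// RintegralD// RintegralZl// RintegralZl// Rintegral_cst//.
  have -> : (centroid K).1 = Rintegral area2 K (fun z => z.1) / fine (Area K) by [].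
  have -> : (centroid K).2 = Rintegral area2 K (fun z => z.2) / fine (Area K) by [].
  rewrite (_ : fine (area2 K) = fine (Area K))//.
  by field; rewrite gt_eqF.
rewrite mulrA ler_pM2r//; move: neg => /=; lra.
Qed.
End Centroid.

(** * The triangle *)

Section Triangle.
Variable R : realType.
Notation plane := (measurableTypeR R * measurableTypeR R)%type.
Notation pt := (R * R)%type.
Notation area2 := (@area2 R).
Implicit Types (a b c : pt) (S : set pt).

Lemma convex_set1 (p : pt) : convex_set2 [set p].
Proof. by move=> _ _ -> -> t _ _; apply: pairP => /=; ring. Qed.

Lemma conv_hull_convex (A : set pt) : convex_set2 (conv_hull A).
Proof.
move=> p q hp hq t h0 h1 C hC; have [cC _] := hC.
by apply: cC => //; [exact: hp|exact: hq].
Qed.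

Lemma conv_hull_sub (A : set pt) : A `<=` conv_hull A.
Proof. by move=> z Az C [_]; apply. Qed.

Lemma conv_hull_min (A C : set pt) : convex_set2 C -> A `<=` C -> conv_hull A `<=` C.
Proof. by move=> cC AC z /(_ C); apply. Qed.

Lemma triangle_compact a b c : compact (conv_hull [set a; b; c]).
Proof.
have -> : conv_hull [set a; b; c] = hull_join [set a] (hull_join [set b] [set c]).
  apply/seteqP; split.
    apply: conv_hull_min; first exact: hull_join_convex.
    move=> z [[->|->]|->]; first exact: hull_join_subl.
      by apply: hull_join_subr; exact: hull_join_subl.
    by apply: hull_join_subr; exact: hull_join_subr.
  have cS := @conv_hull_convex [set a; b; c].
  apply: hull_join_min => //.
    by move=> _ ->; apply: conv_hull_sub; left; left.
  apply: hull_join_min => // _ ->; apply: conv_hull_sub; first by left; right.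
  by right.
have n1 (p : pt) : [set p] !=set0 by exists p.
have k1 (p : pt) : compact [set p] by exact: compact_set1.
apply: hull_join_compact => //; first exact: convex_set1.
- exact: hull_join_convex.
- by exists b; exact: hull_join_subl.
- by apply: hull_join_compact => //; exact: convex_set1.
Qed.

(** Each bracket is [D] times a barycentric coordinate of [z]; the other factor [D] makes the sign
    independent of the orientation. *)
Lemma triangle_barycentric a b c :
  let D := (b.1 - a.1) * (c.2 - a.2) - (b.2 - a.2) * (c.1 - a.1) in
  forall z, conv_hull [set a; b; c] z ->
   [/\ 0 <= D * (det b c - det z c - det b z), 0 <= D * (det c a - det z a - det c z) &
       0 <= D * (det a b - det z b - det a z)].
Proof.
move=> D z; pose C : set pt := [set z | [/\ 0 <= D * (det b c - det z c - det b z), 0 <= D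
    * (det c a - det z a - det c z) &
       0 <= D * (det a b - det z b - det a z)]].
have DD : 0 <= D ^+ 2 by rewrite sqr_ge0.
have sD (x : R) : x = D -> 0 <= D * x by move=> ->; rewrite -expr2.
have s0 (x : R) : x = 0 -> 0 <= D * x by move=> ->; rewrite mulr0.
apply: (@conv_hull_min _ C).
  move=> p q [p1 p2 p3] [q1 q2 q3] t h0 h1; have h1' : 0 <= 1 - t by lra.
  have com (u v w : R) : w = (1 - t) * u + t * v -> 0 <= D * u -> 0 <= D * v -> 0 <= D * w.
    move=> -> hu hv; rewrite (_ : D * _ = (1 - t) * (D * u) + t * (D * v)); last by ring.
    by rewrite addr_ge0// mulr_ge0.
  split.
  - by apply: (com _ _ _ _ p1 q1); rewrite /det /=; ring.
  - by apply: (com _ _ _ _ p2 q2); rewrite /det /=; ring.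
  - by apply: (com _ _ _ _ p3 q3); rewrite /det /=; ring.
move=> p [[->|->]|->]; split; try (by apply: sD; rewrite /det /D; ring); by apply: s0;
    rewrite /det; ring.
Qed.

Lemma simplex_areaD (x y : R) : 0 <= x -> 0 <= y ->
    ((x + y)%:E * simplex_area R = x%:E * simplex_area R + y%:E * simplex_area R)%E.
Proof. by move=> x0 y0; rewrite EFinD ge0_muleDl ?lee_fin. Qed.

(** Equality of the three determinants amounts to [a + b + c = 0]. *)
Lemma det_sum0 a b c z : det a b != 0 -> det b c = det a b -> det c a = det a b ->
  det a z + det b z + det c z = 0.
Proof.
move=> d0 bc ca; apply: (@mulfI _ (det a b)) => //.
have -> : det a b * (det a z + det b z + det c z) =
    (det a b - det c a) * det b z + (det a b - det b c) * det a z.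
  by rewrite /det; ring.
by rewrite ca bc !subrr !mul0r addr0 mulr0.
Qed.

(** Off the three null lines, [det a z], [det b z] and [det c z] are non-zero with sum 0. Their
    signs tell which of the three cones contains [z], and one barycentric inequality then puts [z]
    in the triangle of that cone. *)
Lemma triangle_area_le a b c : 0 < det a b -> det b c = det a b -> det c a = det a b ->
  (Area (conv_hull [set a; b; c]) <= (3 * det a b)%:E * simplex_area R)%E.
Proof.
set d := det a b => d0 bc ca; set S := conv_hull _.
have mS : measurable (S : set plane) by apply: compact_measurable2; exact: triangle_compact.
pose line v : set plane := [set z | det v z = 0].
have ml v : measurable (line v) by exact: measurable_line.
have nz (p q : pt) : det p q = d -> p != (0, 0).
  by move=> pq; apply/eqP => p0; move: pq d0; rewrite p0 /det /= !mul0r subr0 => <-;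
      rewrite ltxx.
have l0 (p q : pt) : det p q = d -> area2 (line p) = 0%E by move=> /nz h; exact: Area_line.
pose Tr p q : set plane := tri p q.
have mT p q : measurable (Tr p q) by exact: measurable_tri.
have aT p q : det p q = d -> area2 (Tr p q) = (d%:E * simplex_area R)%E.
  by move=> pq; rewrite -pq; apply: Area_tri; rewrite pq.
have D0 : 0 < (b.1 - a.1) * (c.2 - a.2) - (b.2 - a.2) * (c.1 - a.1).
  rewrite (_ : _ - _ = det a b + det b c + det c a); last by rewrite /det; ring.
  by rewrite bc ca -/d; lra.
pose U : set plane := Tr a b `|` (Tr b c `|` (Tr c a `|` (line a `|` (line b `|` line c)))).
have SU : S `<=` U.
  move=> z /triangle_barycentric[]; rewrite !pmulr_rge0// => s1 s2 s3.
  have [za|za] := eqVneq (det a z) 0; first by right; right; right; left.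
  have [zb|zb] := eqVneq (det b z) 0; first by right; right; right; right; left.
  have [zc|zc] := eqVneq (det c z) 0; first by right; right; right; right; right.
  have sum0 : det a z + det b z + det c z = 0 by apply: det_sum0; rewrite ?gt_eqF.
  have [e1 [e2 e3]] : det z a = - det a z /\ det z b = - det b z /\ det z c = - det c z.
    by rewrite !(det_antisym z).
  rewrite e1 e2 e3 bc ca -/d in s1 s2 s3.
  case: (ltgtP (det a z) 0) za => // za _; case: (ltgtP (det b z) 0) zb => // zb _;
      case: (ltgtP (det c z) 0) zc => // zc _.
  - lra.
  - by right; right; left; rewrite /Tr /tri /= e1 ca -/d; split; lra.
  - by right; left; rewrite /Tr /tri /= e3 bc -/d; split; lra.
  - by right; right; left; rewrite /Tr /tri /= e1 ca -/d; split; lra.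
  - by left; rewrite /Tr /tri /= e2 -/d; split; lra.
  - by left; rewrite /Tr /tri /= e2 -/d; split; lra.
  - by right; left; rewrite /Tr /tri /= e3 bc -/d; split; lra.
  - lra.
have mU : measurable U by do 5 (apply: measurableU => //).
apply: (le_trans (Area_le mS mU SU)).
have U2 (A B : set plane) x y : measurable A -> measurable B -> (area2 A <= x ->
    area2 B <= y -> area2 (A `|` B) <= x + y)%E.
  move=> mA mB hA hB; apply: (le_trans (@measureU2 _ _ _ area2 _ _ mA mB)); exact: leeD.
have -> : ((3 * d)%:E * simplex_area R = d%:E * simplex_area R + (d%:E * simplex_area R +
    (d%:E * simplex_area R + (0 + (0 + 0)))))%E.
  have d0' := ltW d0; rewrite !adde0 (_ : 3 * d = d + (d + d)); last by ring.
  by rewrite (simplex_areaD d0' (addr_ge0 d0' d0')) (simplex_areaD d0' d0').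
have bb : (0 <= d%:E * simplex_area R)%E by rewrite mule_ge0 ?simplex_area_ge0// lee_fin
    ltW.
apply: (U2); rewrite ?aT//; first by do 4 (apply: measurableU => //).
apply: (U2); rewrite ?aT//; first by do 3 (apply: measurableU => //).
apply: (U2); rewrite ?aT//; first by do 2 (apply: measurableU => //).
apply: (U2); rewrite ?(l0 a b)//; first by apply: measurableU.
by apply: (U2); rewrite ?(l0 b c) ?(l0 c a).
Qed.

Lemma hexagon_area_ge a b c (mu lam : R) (H : set plane) :
  0 < det a b -> det b c = det a b -> det c a = det a b -> 0 < mu -> 0 < lam ->
  measurable H -> convex_set2 H -> H (0, 0) ->
  (forall p, p \in [:: a; b; c] -> H (pscale mu p) /\ H (pscale (- lam) p)) ->
  ((6 * lam * mu * det a b)%:E * simplex_area R <= Area H)%E.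
Proof.
set d := det a b => d0 bc ca mu0 lam0 mH cH H0 Hp.
have [|Ha Ha'] := Hp a; first by rewrite !inE eqxx.
have [|Hb Hb'] := Hp b; first by rewrite !inE eqxx orbT.
have [|Hc Hc'] := Hp c; first by rewrite !inE eqxx !orbT.
(* As [a + b + c = 0], the vector [- c] lies in the cone of [a] and [b], so this order is
   counterclockwise. *)
pose us := [:: pscale mu a; pscale (- lam) c; pscale mu b; pscale (- lam) a; pscale mu c;
    pscale (- lam) b].
pose u (i : 'I_6) := nth (0, 0) us i.
have Hu i : H (u i) by case: i => [[|[|[|[|[|[|//]]]]]] ilt].
pose P (e : 'I_6 * 'I_6) := e.2 == ordS e.1.
have Lm : 0 < lam * mu by rewrite mulr_gt0.
have du i : det (u i) (u (ordS i)) = lam * mu * d.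
  case: i => [[|[|[|[|[|[|//]]]]]] ilt]; rewrite /u /=.
  - by rewrite -ca /det /=; ring.
  - by rewrite -bc /det /=; ring.
  - by rewrite /d /det /=; ring.
  - by rewrite -ca /det /=; ring.
  - by rewrite -bc /det /=; ring.
  - by rewrite /d /det /=; ring.
have sum0 z : det a z + det b z + det c z = 0 by apply: det_sum0; rewrite ?gt_eqF.
(* The signs of [det a z], [det b z], [det c z] on the six cones. *)
pose pat (i : 'I_6) : bool * bool * bool := nth (true, true, true)
  [:: (true, false, true); (true, false, false); (true, true, false);
      (false, true, false); (false, true, true); (false, false, true)] i.
have key i z : in_cone (u i) (u (ordS i)) z ->
    pat i = (0 < det a z, 0 < det b z, 0 < det c z).
  have S0 := sum0 z.
  have zp (p : pt) k : 0 < det z (pscale k p) -> 0 < - k * det p z by rewrite /det /=; lra.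
  have pz (p : pt) k : 0 < det (pscale k p) z -> 0 < k * det p z by rewrite /det /=; lra.
  have pos (k x : R) : 0 < k -> 0 < k * x -> 0 < x by move=> k0; rewrite pmulr_rgt0.
  have neg (k x : R) : 0 < k -> 0 < - k * x -> x < 0 by move=> k0;
      rewrite mulNr oppr_gt0 pmulr_rlt0.
  case: i => [[|[|[|[|[|[|//]]]]]] ilt]; rewrite /u /pat /in_cone /= => -[/zp h1 /pz h2];
      rewrite ?opprK in h1;
    try (move/(neg _ _ mu0): h1 => h1); try (move/(pos _ _ lam0): h1 => h1);
    try (move/(pos _ _ mu0): h2 => h2); try (move/(neg _ _ lam0): h2 => h2);
    case: (ltP 0 (det a z)) => ha; case: (ltP 0 (det b z)) => hb;
        case: (ltP 0 (det c z)) => hc;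
    by [|exfalso; lra].
have -> : ((6 * lam * mu * d)%:E * simplex_area R = \sum_(e | P e) (det (u e.1) (u
    e.2))%:E * simplex_area R)%E.
  transitivity (\sum_(i < 6) (lam * mu * d)%:E * simplex_area R)%E.
    rewrite !big_ord_recl big_ord0 addr0; set k := lam * mu * d.
    have k0 : 0 <= k by rewrite !mulr_ge0// ltW.
    rewrite (_ : 6 * lam * mu * d = k + (k + (k + (k + (k + k))))); last by rewrite /k;
        ring.
    have k2 := addr_ge0 k0 k0; have k3 := addr_ge0 k0 k2; have k4 := addr_ge0 k0 k3;
        have k5 := addr_ge0 k0 k4.
    by rewrite (simplex_areaD k0 k5) (simplex_areaD k0 k4) (simplex_areaD k0 k3)
        (simplex_areaD k0 k2) (simplex_areaD k0 k0).
  transitivity (\sum_(i < 6) \sum_(j < 6 | j == ordS i) (det (u i) (u j))%:E *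
      simplex_area R)%E; last first.
    by rewrite pair_big_dep.
  by apply: eq_bigr => i _; rewrite big_pred1_eq du.
apply: sum_tri_le => //.
- by move=> [e1 e2] /eqP /= ->; rewrite du !mulr_gt0.
- move=> [e1 e2] [f1 f2] z /eqP /= -> /eqP /= -> /key k1 /key k2.
  have {k1 k2} : pat e1 = pat f1 by rewrite k1 k2.
  by move=> /eqP; rewrite nth_uniq// => /eqP/val_inj ->.
Qed.
(** The barycentric coordinate of [- a / 2] at [a] is non-negative, which says
    [D * det b c >= D * D / 3], and likewise at [b] and [c]. The three products add up to [D * D],
    so all are equalities. *)
Lemma triangle_centroid_det (a b c : pt) (S := conv_hull [set a; b; c])
  (D := (b.1 - a.1) * (c.2 - a.2) - (b.2 - a.2) * (c.1 - a.1)) :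
  D != 0 -> (forall p, S p -> S (pscale (- 2^-1) p)) ->
  [/\ det a b = D / 3, det b c = D / 3 & det c a = D / 3].
Proof.
move=> D0 half.
have inS p : [set a; b; c] p -> S (pscale (- 2^-1) p) by move=> pS; apply: half;
    exact: conv_hull_sub.
have [ha _ _] := triangle_barycentric (inS a (or_introl (or_introl erefl))).
have [_ hb _] := triangle_barycentric (inS b (or_introl (or_intror erefl))).
have [_ _ hc] := triangle_barycentric (inS c (or_intror erefl)).
have sD : det a b + det b c + det c a = D by rewrite /det /D; ring.
rewrite -/D in ha hb hc.
have ea : D * (det b c - det (pscale (- 2^-1) a) c - det b (pscale (- 2^-1) a)) = 3 / 2 *
    (D * det b c) - D * D / 2.
  by rewrite -[X in D * X / 2]sD /det /=; field.
have eb : D * (det c a - det (pscale (- 2^-1) b) a - det c (pscale (- 2^-1) b)) = 3 / 2 *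
    (D * det c a) - D * D / 2.
  by rewrite -[X in D * X / 2]sD /det /=; field.
have ec : D * (det a b - det (pscale (- 2^-1) c) b - det a (pscale (- 2^-1) c)) = 3 / 2 *
    (D * det a b) - D * D / 2.
  by rewrite -[X in D * X / 2]sD /det /=; field.
rewrite ea in ha; rewrite eb in hb; rewrite ec in hc.
have sDD : D * det a b + D * det b c + D * det c a = D * D by rewrite -!mulrDr sD.
clearbody S D; split; apply: (mulfI D0); lra.
Qed.

Lemma triangle_hull_area (S : set pt) (lam : R) : triangle S ->
  (forall p, S p -> S (pscale (- 2^-1) p)) -> 0 < lam -> lam < 1 ->
  ((2 * lam * (1 - lam))%:E * Area S <=
   Area (hull_join (scale_set (1 - lam) S) (scale_set (- lam) S)))%E.
Proof.
move=> [a [b [c [D0 SE]]]] half l0 l1.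
have kS : compact S by rewrite SE; exact: triangle_compact.
have cS : convex_set2 S by rewrite SE; exact: conv_hull_convex.
have Sa : S a by rewrite SE; apply: conv_hull_sub; left; left.
have Sb : S b by rewrite SE; apply: conv_hull_sub; left; right.
have Sc : S c by rewrite SE; apply: conv_hull_sub; right.
have S0 : S (0, 0).
  (* 0 divides the segment from [a] to [- a / 2] in the ratio 2 : 1. *)
  have h0 : (0 : R) <= 2 / 3 by lra.
  have h1 : (2 / 3 : R) <= 1 by lra.
  by have := cS _ _ Sa (half _ Sa) _ h0 h1; congr S; apply: pairP => /=; field.
have mu0 : 0 < 1 - lam by lra.
have n1 k : scale_set k S !=set0 by exists (pscale k a); exists a.
set H := hull_join _ _.
have kH : compact H.
  by apply: hull_join_compact => //; (try exact: scale_convex); exact: scale_compact.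
have mH : measurable (H : set plane) by exact: compact_measurable2.
have cH : convex_set2 H by exact: hull_join_convex.
have H0 : H (0, 0).
  by apply: hull_join_subl; exists (0, 0) => //; apply: pairP; rewrite /= mulr0.
have HS p : S p -> H (pscale (1 - lam) p) /\ H (pscale (- lam) p).
  by move=> Sp; split; [apply: hull_join_subl|apply: hull_join_subr]; exists p.
have main (p q r : pt) : S p -> S q -> S r -> S = conv_hull [set p; q; r] ->
    0 < det p q -> det q r = det p q -> det r p = det p q ->
    ((2 * lam * (1 - lam))%:E * Area S <= Area H)%E.
  move=> Sp Sq Sr SE' d0 e1 e2.
  have HA := hexagon_area_ge d0 e1 e2 mu0 l0 mH cH H0.
  apply: le_trans (HA _); last first.
    by move=> v; rewrite !inE => /or3P[]/eqP->; exact: HS.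
  have k0 : (0 <= (2 * lam * (1 - lam))%:E)%E by rewrite lee_fin !mulr_ge0// ltW.
  have := triangle_area_le d0 e1 e2; rewrite -SE' => SA.
  apply: le_trans (lee_wpmul2l k0 SA) _.
  rewrite muleA -EFinM (_ : _ * (3 * _) = 6 * lam * (1 - lam) * det p q)//.
  by ring.
rewrite SE in half; have [e1 e2 e3] := triangle_centroid_det D0 half.
set D := _ - _ in D0 e1 e2 e3.
case: (ltgtP D 0) D0 => // Dn _.
(* A clockwise triangle is relabelled, because [main] wants positive determinants. *)
- apply: (main a c b) => //.
  + by rewrite SE; congr conv_hull; apply/seteqP; split => z [[->|->]|->]; rewrite /=;
      tauto.
  + by rewrite det_antisym e3; lra.
  + by rewrite (det_antisym c b) (det_antisym a c) e2 e3.
  + by rewrite (det_antisym b a) (det_antisym a c) e1 e3.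
- by apply: (main a b c) => //; rewrite ?e1 ?e2 ?e3//; lra.
Qed.

(** The ratio [m / k] is between [-1/2] and 0, so [m / k] times [p] lies on the segment from 0 to
    [- p / 2]. *)
Lemma hull_join_absorb (L : set pt) (k m : R) : convex_set2 L -> L (0, 0) ->
  (forall p, L p -> L (pscale (- 2^-1) p)) -> 0 < `|k| -> m * k <= 0 -> 2 * `|m| <= `|k| ->
  scale_set m L `<=` scale_set k L.
Proof.
move=> cL L0 half k0 mk0 mk _ [p Lp <-].
have k0' : k != 0 by rewrite -normr_gt0.
exists (pscale (m / k) p); last by apply: pairP => /=; field.
have h0 : 0 <= - 2 * (m / k).
  rewrite mulNr oppr_ge0 pmulr_rle0//.
  rewrite (_ : m / k = m * k / k ^+ 2); last by field.
  by rewrite pmulr_lle0// invr_gt0 lt0r sqr_ge0 sqrf_eq0 k0'.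
have h1 : - 2 * (m / k) <= 1.
  apply: le_trans (ler_norm _) _; rewrite normrM normrN normf_div mulrA ler_pdivrMr// mul1r.
  by rewrite ger0_norm.
by have := cL _ _ L0 (half _ Lp) _ h0 h1; congr L; apply: pairP => /=; field.
Qed.

End Triangle.

Theorem theorem4p1 (R : realType) (K : set (R * R)) (lambda : R)
    (S : set (R * R)) :
  convex_body K -> 0 <= lambda -> lambda <= 1 ->
  triangle S -> centroid S = (0, 0) -> Area S = Area K ->
  let x := centroid K in
  (Area (hull_join
           (scale_set (1 - lambda) (translate (pscale (-1) x) K))
           (scale_set lambda (translate x (scale_set (-1) K))))
   <= Area (hull_join (scale_set (1 - lambda) S)
                      (scale_set (- lambda) S)))%E.
Proof.
move=> [kK [cK iK]] l0 l1 tS cenS ASK; cbv zeta.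
have AK0 := body_Area_gt0 kK iK.
have mK := compact_measurable2 kK.
have := fun p => @centroid_half R K p kK cK AK0.
move: (centroid K) => x halfK.
set L := translate (pscale (-1) x) K.
have LP p : L p <-> K (x.1 + p.1, x.2 + p.2).
  split; first by move=> [q Kq <-]; move: Kq; congr K; apply: pairP => /=; ring.
  by move=> Kq; exists (x.1 + p.1, x.2 + p.2) => //; apply: pairP => /=; ring.
have -> : scale_set lambda (translate x (scale_set (-1) K)) = scale_set (- lambda) L.
  apply/seteqP; split => z.
    move=> [_ [_ [q Kq <-] <-] <-]; exists (padd (pscale (-1) x) q); first by exists q.
    by apply: pairP => /=; ring.
  move=> [_ [q Kq <-] <-]; exists (padd x (pscale (-1) q)); last by apply: pairP => /=;
      ring.
  by exists (pscale (-1) q) => //; exists q.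
have kL : compact L by exact: translate_compact.
have cL : convex_set2 L by exact: translate_convex.
have mL := compact_measurable2 kL.
have AL : Area L = Area K by exact: Area_translate.
have halfL p : L p -> L (pscale (- 2^-1) p).
  by move=> /LP/halfK h; apply/LP; move: h; congr K; apply: pairP; rewrite /=; field.
have [p0 /interior_box [e e0 he]] := iK.
have Kp0 : K p0 by apply: he; rewrite subrr normr0.
(* The centroid is interior: [x + w] is one third of the way from the reflected point
   [3 / 2 x - p0 / 2] to [p0 + 3 w], and the bound [e / 6] keeps [3 w] well inside the box around
   [p0]. *)
have near (w : R * R) : `|w.1| <= e / 6 -> `|w.2| <= e / 6 -> L w.
  move=> w1 w2; apply/LP; have Kq := halfK _ Kp0.
  have Kr : K (p0.1 + 3 * w.1, p0.2 + 3 * w.2).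
    by apply: he; rewrite /= addrAC subrr add0r normrM ger0_norm//; lra.
  have h0 : (0 : R) <= 3^-1 by lra.
  have h1 : (3^-1 : R) <= 1 by lra.
  by have := cK _ _ Kq Kr _ h0 h1; congr K; apply: pairP; rewrite /=; field.
have r0 : 0 < e / 6 by rewrite divr_gt0.
have L0 : L (0, 0) by apply: near; rewrite /= normr0 ltW.
have [a [b [c [D0 SE]]]] := tS.
have kS : compact S by rewrite SE; exact: triangle_compact.
have cS : convex_set2 S by rewrite SE; exact: conv_hull_convex.
have mS := compact_measurable2 kS.
have AS0 : 0 < fine (Area S) by rewrite ASK.
have halfS p : S p -> S (pscale (- 2^-1) p).
  by move=> /(centroid_half kS cS AS0); rewrite cenS; congr S; apply: pairP => /=; ring.
have Sa : S a by rewrite SE; apply: conv_hull_sub; left; left.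
have mH T : compact T -> convex_set2 T -> T !=set0 ->
    @measurable _ (measurableTypeR R * measurableTypeR R)%type
    (hull_join (scale_set (1 - lambda) T) (scale_set (- lambda) T)).
  move=> kT cT [q Tq]; have nT k : scale_set k T !=set0 by exists (pscale k q); exists q.
  apply: compact_measurable2; apply: hull_join_compact => //; (try exact: scale_convex);
    exact: scale_compact.
have mHS := mH S kS cS (ex_intro _ a Sa).
have mHL := mH L kL cL (ex_intro _ (0, 0) L0).
have [la|la] := ltP lambda 3^-1.
  have mu0 : 0 < 1 - lambda by lra.
  apply: (@le_trans _ _ (Area (scale_set (1 - lambda) L))).
    apply: Area_le => //; first by apply: measurable_scale => //; rewrite gt_eqF.
    apply: hull_join_min => //; first exact: scale_convex.
    apply: hull_join_absorb => //; rewrite ?normrN ?(gtr0_norm mu0) ?(ger0_norm l0)//;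
        last by lra.
    by rewrite mulNr oppr_le0 mulr_ge0// ltW.
  rewrite Area_scale ?gt_eqF// AL -ASK -Area_scale ?gt_eqF//.
  apply: Area_le => //; first by apply: measurable_scale => //; rewrite gt_eqF.
  exact: hull_join_subl.
have [lb|lb] := ltP (2 / 3) lambda.
  have la0 : - lambda != 0 by rewrite oppr_eq0 gt_eqF//; lra.
  apply: (@le_trans _ _ (Area (scale_set (- lambda) L))).
    apply: Area_le => //; first exact: measurable_scale.
    have mu0 : 0 <= 1 - lambda by lra.
    apply: hull_join_min => //; first exact: scale_convex.
    apply: hull_join_absorb => //; rewrite ?normrN ?(ger0_norm mu0) ?(ger0_norm l0)//;
        try by lra.
    by rewrite mulrN oppr_le0 mulr_ge0.
  rewrite Area_scale// AL -ASK -Area_scale//.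
  apply: Area_le => //; first exact: measurable_scale.
  exact: hull_join_subr.
apply: (@le_trans _ _ ((2 * lambda * (1 - lambda))%:E * Area L)%E).
  by apply: (@hull_area_mid R L lambda (e / 6)) => //;
    apply: near; rewrite /= ?normrN ?normr0 ?(gtr0_norm r0) ?lexx // ltW.
by rewrite AL -ASK; apply: triangle_hull_area => //; lra.
Qed.
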